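(* Fix an integer $r \ge 2$ and an $r$-critical graph $F$. There exists $\delta=\delta_F>0$ such that if $n$ is sufficiently large and $q$ is an integer with $1 \le q < \delta n$, then every $n$-vertex graph with $t_r(n)+q$ edges contains at least $q\, c(n,F)$ copies of $F$.
   Context: Graphs are finite and simple. A graph $F$ is $r$-critical if it has chromatic number $r+1$ and it contains an edge whose deletion reduces the chromatic number to $r$ (no condition is imposed on other edges or subgraphs). A copy of $F$ in a graph $H$, where $F$ has $f$ vertices and $|F|$ edges, is a subset of $f$ vertices of $H$ together with $|F|$ edges of $H$ such that the subgraph formed by these vertices and edges is isomorphic to $F$ (not necessarily induced); equivalently, the number of copies of $F$ in $H$ is the number of edge-preserving injections $V(F)\to V(H)$ divided by the number of automorphisms of $F$. The Turán graph $T_r(n)$ is the $n$-vertex $r$-partite graph with the maximum number of edges: it is complete $r$-partite and its parts all have size $\lceil n/r\rceil$ or $\lfloor n/r\rfloor$. Its number of edges is $t_r(n)=\sum_{1\le i<j\le r}\lfloor\frac{n+i-1}{r}\rfloor\lfloor\frac{n+j-1}{r}\rfloor$. For an $r$-critical graph $F$, $c(n,F)$ denotes the minimum number of copies of $F$ in a graph obtained from $T_r(n)$ by adding one edge (the minimum is over the choice of the added edge, which lies inside a part). *)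

(* Defs.v *)
From HB Require Import structures.
From mathcomp Require Import all_boot all_order all_algebra.
From mathcomp Require Import zify.
From mathcomp Require Import reals.

Set Implicit Arguments.
Unset Strict Implicit.
Unset Printing Implicit Defensive.

Record sgraph (V : finType) := SGraph {
  edges : {set {set V}};
  edges_simple : [forall e in edges, #|e| == 2]
}.

HB.instance Definition _ (V : finType) := [isSub for @edges V].
HB.instance Definition _ (V : finType) := [Finite of sgraph V by <:].

Definition adj (V : finType) (G : sgraph V) : rel V :=
  fun x y => [set x; y] \in edges G.

Lemma card_edge (V : finType) (G : sgraph V) e : e \in edges G -> #|e| = 2.
Proof. by move=> eG; apply/eqP; apply: (forall_inP (edges_simple G)). Qed.

Lemma adjxx (V : finType) (G : sgraph V) x : adj G x x = false.
Proof. by apply/negP => /card_edge; rewrite cards2 eqxx. Qed.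

Lemma del_edge_simple (V : finType) (G : sgraph V) (e : {set V}) :
  [forall e' in edges G :\ e, #|e'| == 2].
Proof. by apply/forall_inP => e' /setD1P[_ /card_edge ->]. Qed.

Definition del_edge (V : finType) (G : sgraph V) (e : {set V}) : sgraph V :=
  SGraph (del_edge_simple G e).

Definition is_colorable (V : finType) (G : sgraph V) (k : nat) : bool :=
  [exists c : {ffun V -> 'I_k},
     [forall x, forall y, adj G x y ==> (c x != c y)]].

Lemma ex_colorable (V : finType) (G : sgraph V) : exists k, is_colorable G k.
Proof.
exists #|V|; apply/existsP; exists [ffun x => enum_rank x].
apply/forallP => x; apply/forallP => y; apply/implyP => xy.
rewrite !ffunE (inj_eq enum_rank_inj).
by apply: contraTneq xy => ->; rewrite adjxx.
Qed.

Definition chromatic_number (V : finType) (G : sgraph V) : nat :=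
  ex_minn (ex_colorable G).

Definition critical (r : nat) (V : finType) (F : sgraph V) : Prop :=
  chromatic_number F = r.+1 /\
  exists2 e, e \in edges F & chromatic_number (del_edge F e) = r.

(* The vertex set S is part of a copy, so isolated vertices of F matter.      *)
Definition is_copy (V W : finType) (F : sgraph V) (H : sgraph W)
    (S : {set W}) (E : {set {set W}}) : bool :=
  (E \subset edges H) &&
  [exists f : {ffun V -> W},
     [&& injectiveb f, S == f @: [set: V]
       & E == [set f @: (e : {set V}) | e in edges F]]].

Definition copies (V W : finType) (F : sgraph V) (H : sgraph W) : nat :=
  #|[set C : {set W} * {set {set W}} | is_copy F H C.1 C.2]|.

Lemma turan_simple (r n : nat) :
  [forall e in [set e : {set 'I_n} | [exists x : 'I_n, exists y : 'I_n,
                  (x %% r != y %% r) && (e == [set x; y])]], #|e| == 2].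
Proof.
apply/forall_inP => e; rewrite inE => /existsP[x /existsP[y /andP[xy /eqP->]]].
by have ne_xy : x != y; [apply: contraNneq xy => -> | rewrite cards2 ne_xy].
Qed.

(* The parts of T_r(n) are the residue classes modulo r in {0, ..., n-1}.     *)
Definition turan (r n : nat) : sgraph 'I_n := SGraph (turan_simple r n).

Definition turan_size (r n : nat) : nat :=
  \sum_(1 <= i < r.+1) \sum_(i.+1 <= j < r.+1)
     ((n + i - 1) %/ r) * ((n + j - 1) %/ r).

Lemma adj_turan (r n : nat) (x y : 'I_n) :
  adj (turan r n) x y = (x %% r != y %% r).
Proof.
rewrite /adj inE; apply/idP/idP => [|xy]; last first.
  by apply/existsP; exists x; apply/existsP; exists y; rewrite xy eqxx.
move=> /existsP[x' /existsP[y' /andP[xy' /eqP e]]].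
apply: contraNneq xy' => xy.
have := set21 x' y'; have := set22 x' y'; rewrite -e !inE.
by move=> /pred2P[]-> /pred2P[]->; rewrite ?xy.
Qed.

Lemma card_turan_part (r n k : nat) : k < r ->
  #|[set x : 'I_n | x %% r == k]| = (n + (r - k) - 1) %/ r.
Proof.
move=> kr; rewrite cardsE -sum1_card big_mkcond /=.
under eq_bigr => i _ do rewrite -topredE /=.
elim: n => [|n IHn]; first by rewrite big_ord0 divn_small //; lia.
rewrite big_ord_recr /= IHn.
have -> : n.+1 + (r - k) - 1 = (n + (r - k) - 1).+1 by lia.
rewrite divnS; last by lia.
rewrite addnC; congr (_ + _).
have -> : (n + (r - k) - 1).+1 = n + (r - k) by lia.
have -> : (r %| n + (r - k)) = (n %% r == k).
  rewrite -{2}(modn_small kr) -(eqn_modDr (r - k)).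
  by rewrite subnKC ?modnn /dvdn // ltnW.
by rewrite -eqnE; case: eqn.
Qed.

Lemma card_turan (r n : nat) : 0 < r ->
  #|edges (turan r n)| = turan_size r n.
Proof.
move=> r_gt0.
pose P := [set p : 'I_n * 'I_n | p.1 %% r < p.2 %% r].
have -> : edges (turan r n) = [set [set p.1; p.2] | p in P].
  apply/setP => e; rewrite inE; apply/existsP/imsetP.
    move=> [x /existsP[y /andP[xy /eqP->]]].
    case: (ltnP (x %% r) (y %% r)) => xy'; first by exists (x, y); rewrite ?inE.
    exists (y, x); last by rewrite setUC.
    by rewrite inE /= ltn_neqAle xy' eq_sym xy.
  move=> [[x y]]; rewrite inE /= => xy ->.
  by exists x; apply/existsP; exists y; rewrite eqxx andbT neq_ltn xy.
rewrite card_in_imset; last first.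
  move=> [x y] [x' y']; rewrite !inE /= => xy xy' e.
  have := set21 x y; have := set22 x y; rewrite e !inE.
  move=> /pred2P[]yE /pred2P[]xE; move: xy; rewrite ?xE ?yE ?ltnn //.
  by move=> /ltn_trans/(_ xy'); rewrite ltnn.
pose a k := #|[set x : 'I_n | x %% r == k]|.
have -> : #|P| = \sum_(k < r) \sum_(l < r | k < l) a k * a l.
  pose h (x : 'I_n) : 'I_r := Ordinal (ltn_pmod x r_gt0).
  rewrite -sum1_card.
  rewrite (partition_big (fun p : 'I_n * 'I_n => h p.1) xpredT) //=.
  apply: eq_bigr => k _.
  rewrite (partition_big (fun p : 'I_n * 'I_n => h p.2) (fun l => k < l)) /=.
    apply: eq_bigr => l kl; rewrite sum1_card -cardsX; apply: eq_card => -[x y].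
    rewrite !inE -!topredE /= !inE -!val_eqE /=.
    by case: eqP => [->|]; rewrite ?andbF //; case: eqP => [->|]; rewrite ?andbF ?kl.
  by move=> [x y]; rewrite inE /= => /andP[+ /eqP<-].
rewrite (exchange_big_dep xpredT) //= (reindex_inj rev_ord_inj) /=.
rewrite /turan_size big_add1 /= big_mkord; apply: eq_bigr => l _.
rewrite (reindex_inj rev_ord_inj) /= big_add1 /= (big_nat_widenl _ 0) //.
rewrite big_mkord; apply: eq_big => k /=.
  by have := ltn_ord l; have := ltn_ord k; lia.
move=> _; have lr := ltn_ord l; have kr := ltn_ord k.
rewrite /a !card_turan_part; try lia.
by rewrite mulnC; congr (_ %/ _ * (_ %/ _)); lia.
Qed.

Definition is_turan_plus_edge (r n : nat) (G : sgraph 'I_n) : bool :=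
  [exists e, (e \notin edges (turan r n)) &&
             (edges G == e |: edges (turan r n))].

(* The default value [turan r n] only matters when no edge can be added to    *)
(* the Turan graph, that is, when n <= r.                                     *)
Definition min_copies (r n : nat) (V : finType) (F : sgraph V) : nat :=
  copies F [arg min_(G < turan r n | is_turan_plus_edge r G) copies F G].

Lemma ex_turan_plus_edge (r n : nat) : 0 < r < n ->
  exists G : sgraph 'I_n, is_turan_plus_edge r G.
Proof.
case/andP=> r0 rn.
pose x := Ordinal (ltn_trans r0 rn); pose y := Ordinal rn.
pose e := [set x; y].
have e2 : #|e| == 2 by rewrite cards2 -val_eqE /= neq_ltn r0.
have s : [forall e' in e |: edges (turan r n), #|e'| == 2].
  by apply/forall_inP => e' /setU1P[->//|/card_edge->].
exists (SGraph s); apply/existsP; exists e; rewrite eqxx andbT.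
by have := adj_turan r x y; rewrite /adj => ->; rewrite /= mod0n modnn eqxx.
Qed.

Lemma min_copiesP (r n : nat) (V : finType) (F : sgraph V) : 0 < r < n ->
  exists2 G : sgraph 'I_n,
    is_turan_plus_edge r G /\ min_copies r n F = copies F G &
    forall G' : sgraph 'I_n, is_turan_plus_edge r G' ->
      min_copies r n F <= copies F G'.
Proof.
move=> /ex_turan_plus_edge[G0 G0P]; rewrite /min_copies.
set G := arg_min _ _ _.
have [GP Gmin] : is_turan_plus_edge r G /\
    forall G' : sgraph 'I_n, is_turan_plus_edge r G' -> copies F G <= copies F G'.
  rewrite /G /arg_min /extremum; case: pickP => [G1 /andP[G1P /forallP G1min]|].
    by split=> // G' G'P; apply: (implyP (G1min G')).
  have [G1 G1P G1min] := arg_minnP (copies F) G0P.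
  by move/(_ G1)/negP; case; rewrite /= G1P; apply/forall_inP.
by exists G.
Qed.

(* Main.v *)
(*
Let B be the set of edges of H inside the parts of a maximum r-cut of H, let M
be the set of missing edges between different parts, and let D be the edge
deficit of the complete r-partite graph on these parts with respect to the
Turan graph; then |B| = q + |M| + D.

If H has fewer than q c(n,F) copies of F, it has o(n^f) copies; since F is
(r+1)-colourable, duplicating vertices and Cauchy-Schwarz show that H has
o(n^(r+1)) copies of K_(r+1). Stability follows without the regularity lemma:
by the Moon-Moser inequalities the graph is almost regular, and for a typical
r-clique K the classes "adjacent to all of K but its i-th vertex" cover almost
all vertices and span few edges, so that |B| = o(n^2).

If |B| is linear in n with a small constant, each edge of B lies in almost
c(n,F) copies of F without other edges of B, and the losses, which are at most
a small multiple of (|M| + D) n^(f-2), are paid for by the |M| + D surplus edges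
of B. If |B| is larger, then either a vertex x has linear degree in B, hence by
maximality of the cut linear degree in all parts, and already the copies that
map an end of the critical edge to x are too many; or most edges of B meet few
edges of M and each of them lies in about n^(f-2) copies.
*)
Require Import Defs.
From mathcomp Require Import all_boot all_order all_algebra.
From mathcomp Require Import reals.
From mathcomp Require Import perm ring lra zify.

Set Implicit Arguments.
Unset Strict Implicit.
Unset Printing Implicit Defensive.

Import Order.TTheory GRing.Theory Num.Theory.

(** * Averages over maps *)

(** The bound is exact: no factor 1 - o(1) may be lost on q c(n,F). Therefore, for each edge of B
    separately, the parts are rebalanced with both ends of that edge kept in place, and H is
    compared with a genuine Turan graph plus that edge, which has at least c(n,F) copies. Only
    copies with exactly one edge in B are counted, so that summing over B counts no copy twice.

    Summed over B, the loss has order |B| (|M| + D) n^(f-3). The surplus is (|M| + D) c(n,F), and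
    c(n,F) has order n^(f-2); this is why the border between few and many edges of B is linear in n.
    The condition q < delta n makes q c(n,F) a small multiple of n^(f-1), and both alternatives for
    a larger B produce more copies than that.

    Densities are averages over all maps, injective or not: adding a vertex is then averaging over
    one more coordinate, and coincidences of values are a separate error of order 1/n. *)

Section Average.
Local Open Scope ring_scope.
Variables (R : realFieldType) (I W : finType).
Implicit Types (g h : {ffun I -> W} -> R) (phi : {ffun I -> W}) (i z : I) (w : W).

Definition upd phi i w : {ffun I -> W} :=
  [ffun j => if j == i then w else phi j].

Lemma updE phi i w j : upd phi i w j = if j == i then w else phi j.
Proof. by rewrite ffunE. Qed.

Definition avg g : R := (\sum_phi g phi) / #|W|%:R ^+ #|I|.

Lemma eq_avg g h : (forall phi, g phi = h phi) -> avg g = avg h.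
Proof. by move=> gh; rewrite /avg (eq_bigr _ (fun phi _ => gh phi)). Qed.

Lemma avgD g h : avg (fun phi => g phi + h phi) = avg g + avg h.
Proof. by rewrite /avg big_split mulrDl. Qed.

Lemma avgZ k g : avg (fun phi => k * g phi) = k * avg g.
Proof. by rewrite /avg -mulr_sumr mulrA. Qed.

Lemma avg_sum (J : Type) (r : seq J) (P : pred J) (G : J -> {ffun I -> W} -> R) :
  avg (fun phi => \sum_(j <- r | P j) G j phi) = \sum_(j <- r | P j) avg (G j).
Proof. by rewrite /avg exchange_big mulr_suml. Qed.

Lemma ler_avg g h : (forall phi, g phi <= h phi) -> avg g <= avg h.
Proof.
by move=> gh; rewrite ler_wpM2r ?invr_ge0 ?exprn_ge0 ?ler0n // ler_sum.
Qed.

Lemma avg_ge0 g : (forall phi, 0 <= g phi) -> 0 <= avg g.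
Proof.
by move=> g0; rewrite divr_ge0 ?exprn_ge0 ?ler0n // sumr_ge0.
Qed.

Hypothesis W_gt0 : (0 < #|W|)%N.

Let n_gt0 : 0 < #|W|%:R :> R. Proof. by rewrite ltr0n. Qed.

Lemma avg_cst k : avg (fun=> k) = k.
Proof.
rewrite /avg sumr_const card_ffun -[k *+ _]mulr_natr natrX mulfK //.
by rewrite expf_neq0 // gt_eqF.
Qed.

Lemma avg_eq0 g : (forall phi, 0 <= g phi) -> avg g = 0 -> forall phi, g phi = 0.
Proof.
move=> g0 /eqP; rewrite /avg mulf_eq0 invr_eq0 expf_eq0 [#|W|%:R == 0]gt_eqF // andbF orbF.
by move=> /eqP/psumr_eq0P s0 phi; apply: s0.
Qed.

(** Fubini for a single coordinate: exchanging [w] with [phi i] is an involution on the pairs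
    [(phi, w)] that carries [g (upd phi i w)] to [g phi]. *)
Lemma avg_upd i g : avg g = avg (fun phi => (\sum_w g (upd phi i w)) / #|W|%:R).
Proof.
rewrite /avg -mulr_suml; congr (_ / _).
apply: (mulIf (lt0r_neq0 n_gt0)); rewrite divfK ?gt_eqF // pair_bigA /=.
have -> : (\sum_phi g phi) * #|W|%:R = \sum_(p : {ffun I -> W} * W) g p.1.
  rewrite -(pair_bigA _ (fun phi (_ : W) => g phi)) /= mulr_suml.
  by apply: eq_bigr => phi _; rewrite sumr_const mulr_natr.
pose s (p : {ffun I -> W} * W) := (upd p.1 i p.2, p.1 i).
have sK : involutive s.
  move=> [phi w]; rewrite /s /= updE eqxx; congr pair.
  by apply/ffunP => j; rewrite !updE; case: eqP => [->|].
by rewrite (reindex_inj (inv_inj sK)).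
Qed.

(** Weighted Cauchy-Schwarz: with [a] and [b] the averages of [A] and [A * X], expand the
    nonnegative average of [A * (a * X - b) ^+ 2]. If [a = 0], the weight vanishes everywhere. *)
Lemma avg_CS A X : (forall phi, 0 <= A phi) ->
  avg (fun phi => A phi * X phi) ^+ 2 <= avg A * avg (fun phi => A phi * X phi ^+ 2).
Proof.
move=> A0; set a := avg A; set b := avg _; set c := avg (fun _ => _ * _ ^+ _).
have a0 : 0 <= a by apply: avg_ge0.
have [a_eq0|a_neq0] := eqVneq a 0.
  have Az := avg_eq0 A0 a_eq0.
  rewrite a_eq0 mul0r /b (eq_avg (h := fun=> 0)) ?avg_cst ?expr0n //.
  by move=> phi; rewrite Az mul0r.
have a_gt0 : 0 < a by rewrite lt_neqAle eq_sym a_neq0.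
have : 0 <= avg (fun phi => A phi * (a * X phi - b) ^+ 2).
  by apply: avg_ge0 => phi; rewrite mulr_ge0 ?sqr_ge0.
rewrite (eq_avg (h := fun phi => a ^+ 2 * (A phi * X phi ^+ 2) +
   ((- 2 * a * b) * (A phi * X phi) + b ^+ 2 * A phi))); last by move=> phi; ring.
rewrite !avgD !avgZ -/a -/b -/c.
have -> : a ^+ 2 * c + (- 2 * a * b * b + b ^+ 2 * a) = a * (a * c - b ^+ 2) by ring.
by rewrite pmulr_rge0 // subr_ge0.
Qed.

(* [D phi] is evaluated at two coordinates on which it does not depend:       *)
(* conditionally on the others, these are independent copies.                 *)
Lemma avg_dup i z A (D : {ffun I -> W} -> W -> R) : i != z ->
  (forall phi, 0 <= A phi) ->
  (forall phi w, A (upd phi i w) = A phi) -> (forall phi w, A (upd phi z w) = A phi) ->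
  (forall phi w, D (upd phi i w) =1 D phi) -> (forall phi w, D (upd phi z w) =1 D phi) ->
  avg (fun phi => A phi * D phi (phi i)) ^+ 2 <=
  avg A * avg (fun phi => A phi * (D phi (phi i) * D phi (phi z))).
Proof.
(* [m phi] is the conditional mean of [D phi]. Resampling [i] and [z] turns the two averages into
   those of [A * m] and [A * m ^+ 2]. *)
move=> iz A0 Ai Az Di Dz; pose m phi := (\sum_w D phi w) / #|W|%:R.
have mi phi w : m (upd phi i w) = m phi by rewrite /m (eq_bigr _ (fun x _ => Di phi w x)).
have -> : avg (fun phi => A phi * D phi (phi i)) = avg (fun phi => A phi * m phi).
  rewrite (avg_upd i); apply: eq_avg => phi; rewrite /m mulrA mulr_sumr.
  by congr (_ / _); apply: eq_bigr => w _; rewrite Ai Di updE eqxx.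
have -> : avg (fun phi => A phi * (D phi (phi i) * D phi (phi z))) =
    avg (fun phi => A phi * m phi * D phi (phi i)).
  rewrite (avg_upd z); apply: eq_avg => phi; rewrite mulrAC /m mulrA mulr_sumr.
  congr (_ / _); apply: eq_bigr => w _.
  by rewrite Az !Dz !updE eqxx (negPf iz) mulrA.
have -> : avg (fun phi => A phi * m phi * D phi (phi i)) =
    avg (fun phi => A phi * m phi ^+ 2).
  rewrite (avg_upd i); apply: eq_avg => phi; rewrite expr2 mulrA {2}/m mulrA mulr_sumr.
  by congr (_ / _); apply: eq_bigr => w _; rewrite Ai mi Di updE eqxx.
exact: avg_CS.
Qed.

End Average.

(** * Homomorphism densities and blow-ups *)

Section CliqueDensity.
Local Open Scope ring_scope.
Variables (R : realFieldType) (I W : finType) (e : rel W).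
Hypotheses (e_sym : symmetric e) (W_gt0 : (0 < #|W|)%N).
Implicit Types (phi : {ffun I -> W}) (i z : I) (w : W) (S T : {set I}).

Definition hom_on (C : eqType) (c : I -> C) S phi :=
  [forall i in S, forall j in S, (c i != c j) ==> e (phi i) (phi j)].

(* The average runs over maps of all of [I], though only the images of [S] are *)
(* constrained: densities for different [S] then live on one space.           *)
Definition hom_density (C : eqType) (c : I -> C) S : R :=
  avg (fun phi => (hom_on c S phi)%:R).

Definition sees T phi w := [forall j in T, e (phi j) w].

Lemma hom_onP (C : eqType) (c : I -> C) S phi :
  reflect {in S &, forall i j, c i != c j -> e (phi i) (phi j)} (hom_on c S phi).
Proof.
apply: (iffP forall_inP) => [h i j iS jS cij|h i iS].
  by have /forall_inP/(_ j jS)/implyP := h i iS; apply.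
by apply/forall_inP => j jS; apply/implyP => cij; apply: h.
Qed.

Lemma hom_density_ge0 (C : eqType) (c : I -> C) S : 0 <= hom_density c S.
Proof. by apply: avg_ge0 => phi; apply: ler0n. Qed.

Lemma hom_density_le1 (C : eqType) (c : I -> C) S : hom_density c S <= 1.
Proof.
rewrite -[leRHS](avg_cst (R := R) I W_gt0); apply: ler_avg => phi.
by rewrite lern1 leq_b1.
Qed.

Lemma hom_on_upd (C : eqType) (c : I -> C) S phi i w : i \notin S ->
  hom_on c S (upd phi i w) = hom_on c S phi.
Proof.
move=> iS; apply/hom_onP/hom_onP => h j k jS kS /(h _ _ jS kS);
  by rewrite !updE !ifN //; apply: contraNneq iS => <-.
Qed.

Lemma sees_upd T phi i w x : i \notin T -> sees T (upd phi i w) x = sees T phi x.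
Proof.
move=> iT; apply: eq_forallb_in => j jT.
by rewrite !updE !ifN //; apply: contraNneq iT => <-.
Qed.

Section Twin.
Variables (C : eqType) (c : I -> C).

Let rival S i := [set j in S | c j != c i].

Lemma hom_on_twin S i phi : i \in S ->
  hom_on c S phi = hom_on c (S :\ i) phi && sees (rival S i) phi (phi i).
Proof.
move=> iS; apply/idP/andP => [/hom_onP h|[/hom_onP h /forall_inP h']].
  split; first by apply/hom_onP => j k /setD1P[_ jS] /setD1P[_ kS]; apply: h.
  by apply/forall_inP => j; rewrite inE => /andP[jS cj]; apply: h.
apply/hom_onP => j k jS kS cjk.
have [ji|ji] := eqVneq j i.
  by rewrite e_sym ji h' // inE kS eq_sym -ji.
have [ki|ki] := eqVneq k i; first by rewrite ki h' // inE jS -ki.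
by apply: h; rewrite // !inE ?ji ?ki.
Qed.

Lemma hom_on_setU1 S i z phi : i \in S -> z \notin S -> c z = c i ->
  hom_on c (z |: S) phi = hom_on c S phi && sees (rival S i) phi (phi z).
Proof.
move=> iS zS cz; rewrite (@hom_on_twin _ z) ?setU11 // setU1K //.
congr (_ && _); apply: eq_forallb => j.
by congr (_ ==> _); rewrite !inE cz andb_orl; case: eqP => [->|//]; rewrite cz eqxx.
Qed.

(** Vertices of one colour face the same constraints and none from each other, so given the rest
    their images are independent copies and [avg_dup] applies; its first factor is at most 1. *)
Lemma hom_density_twin S i z : i \in S -> z \notin S -> c z = c i ->
  hom_density c S ^+ 2 <= hom_density c (z |: S).
Proof.
move=> iS zS cz; have iz : i != z by apply: contraNneq zS => <-.
pose D phi w : R := (sees (rival S i) phi w)%:R.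
have iN : i \notin rival S i by rewrite !inE eqxx andbF.
have zN : z \notin rival S i by rewrite !inE (negPf zS).
have -> : hom_density c S = avg (fun phi => (hom_on c (S :\ i) phi)%:R * D phi (phi i)).
  by apply: eq_avg => phi; rewrite (@hom_on_twin S i) // -mulnb natrM.
have -> : hom_density c (z |: S) =
    avg (fun phi => (hom_on c (S :\ i) phi)%:R * (D phi (phi i) * D phi (phi z))).
  apply: eq_avg => phi; rewrite (@hom_on_setU1 S i) // (@hom_on_twin S i) //.
  by rewrite -!mulnb !natrM mulrA.
apply: le_trans (avg_dup W_gt0 iz _ _ _ _ _) _.
- by move=> phi; apply: ler0n.
- by move=> phi w; rewrite hom_on_upd // setD11.
- by move=> phi w; rewrite hom_on_upd // !inE (negPf zS) andbF.
- by move=> phi w x; rewrite /D sees_upd.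
- by move=> phi w x; rewrite /D sees_upd.
rewrite ler_piMl ?hom_density_le1 //.
by apply: avg_ge0 => phi; rewrite !mulr_ge0 ?ler0n.
Qed.

(** Each vertex outside [S] is added as a twin of a vertex of [S], and each addition at worst
    squares the density; hence the exponent. *)
Lemma hom_density_blowup S : (forall z, exists2 i, i \in S & c z = c i) ->
  hom_density c S ^+ (2 ^ #|~: S|) <= hom_density c setT.
Proof.
have [k] := ubnP #|~: S|; elim: k S => // k IHk S /ltnSE leS cS.
have [/eqP|/set0Pn[z]] := eqVneq (~: S) set0.
  by move=> /eqP S0; rewrite -(setCK S) S0 setC0 setCT cards0 expr1.
rewrite in_setC => zS; have [i iS czi] := cS z.
have card_S : #|~: S| = #|~: (z |: S)|.+1.
  by rewrite setCU setIC -setDE (cardsD1 z (~: S)) in_setC zS.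
have cS' z' : exists2 i' : I, i' \in z |: S & c z' = c i'.
  by have [i' i'S ->] := cS z'; exists i'; rewrite ?setU1r.
rewrite card_S in leS *; rewrite expnS exprM; apply: le_trans (IHk (z |: S) leS cS').
by rewrite lerXn2r ?nnegrE ?exprn_ge0 ?hom_density_ge0 // (hom_density_twin iS).
Qed.

End Twin.
End CliqueDensity.

(** * The Moon-Moser inequality *)

Section MoonMoser.
Local Open Scope ring_scope.
Variables (R : realFieldType) (I W : finType) (e : rel W).
Hypotheses (e_sym : symmetric e) (W_gt0 : (0 < #|W|)%N).
Implicit Types (phi : {ffun I -> W}) (i z : I) (w : W) (S T : {set I}).

Definition clique_density S : R := hom_density R e id S.

Lemma clique_ge0 S : 0 <= clique_density S.
Proof. exact: hom_density_ge0. Qed.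

Lemma clique_le1 S : clique_density S <= 1.
Proof. exact: hom_density_le1. Qed.

Lemma hom_on_cliqueD1 S i phi : i \in S ->
  hom_on e id S phi = hom_on e id (S :\ i) phi && sees e (S :\ i) phi (phi i).
Proof.
move=> iS; rewrite (@hom_on_twin _ _ e e_sym _ id S i) //; congr (_ && _).
by apply: eq_forallb => j; rewrite !inE andbC.
Qed.

Lemma hom_on_cliqueU1 S z phi : z \notin S ->
  hom_on e id (z |: S) phi = hom_on e id S phi && sees e S phi (phi z).
Proof. by move=> zS; rewrite (@hom_on_cliqueD1 _ z) ?setU11 // setU1K. Qed.

(** Pairs of vertices that both complete one clique on [S :\ i]; nothing is asked between the two,
    which may even coincide. *)
Definition cherry_density S i z : R :=
  avg (fun phi => (hom_on e id (S :\ i) phi)%:R *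
    ((sees e (S :\ i) phi (phi i))%:R * (sees e (S :\ i) phi (phi z))%:R)).

Lemma cherry_ge S i z : i \in S -> z \notin S ->
  clique_density S ^+ 2 <= clique_density (S :\ i) * cherry_density S i z.
Proof.
move=> iS zS; have iz : i != z by apply: contraNneq zS => <-.
pose D phi w : R := (sees e (S :\ i) phi w)%:R.
have iN : i \notin S :\ i by rewrite !inE eqxx.
have zN : z \notin S :\ i by rewrite !inE (negPf zS) andbF.
have -> : clique_density S =
    avg (fun phi => (hom_on e id (S :\ i) phi)%:R * D phi (phi i)).
  by apply: eq_avg => phi; rewrite (@hom_on_cliqueD1 S i) // -mulnb natrM.
apply: (avg_dup W_gt0 iz).
- by move=> phi; apply: ler0n.
- by move=> phi w; rewrite hom_on_upd.
- by move=> phi w; rewrite hom_on_upd.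
- by move=> phi w x; rewrite /D sees_upd.
- by move=> phi w x; rewrite /D sees_upd.
Qed.

(* If [phi] is a clique on [S], a vertex adjacent to all but one member of it *)
(* is either counted for a single [i], or completes a larger clique.          *)
Lemma cherry_sum_le S z : z \notin S ->
  \sum_(i in S) cherry_density S i z <=
  clique_density S + #|S|.-1%:R * clique_density (z |: S).
Proof.
move=> zS; rewrite -avg_sum -avgZ -avgD; apply: ler_avg => phi.
rewrite hom_on_cliqueU1 //.
rewrite (eq_bigr (fun i => (hom_on e id S phi)%:R * (sees e (S :\ i) phi (phi z))%:R));
  last by move=> i iS; rewrite (@hom_on_cliqueD1 S i) // -mulnb natrM mulrA.
rewrite -mulr_sumr; case: (hom_on e id S phi) => /=; last by rewrite !mul0r mulr0 addr0.
rewrite mul1r; have [allS|/forall_inPn[j jS zj]] := boolP (sees e S phi (phi z)).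
  rewrite mulr1 nat1r.
  apply: le_trans (_ : \sum_(i in S) 1 <= _).
    by apply: ler_sum => i _; rewrite lern1 leq_b1.
  by rewrite sumr_const ler_nat leqSpred.
rewrite mulr0 addr0 (bigD1 j) //= big1 ?addr0 ?lern1 ?leq_b1 // => i /andP[iS ij].
suff /negPf-> : ~~ sees e (S :\ i) phi (phi z) by [].
by apply/forall_inPn; exists j; rewrite // !inE eq_sym ij.
Qed.

Lemma clique_density_perm (s : {perm I}) S : clique_density (s @: S) = clique_density S.
Proof.
pose f phi : {ffun I -> W} := [ffun i => phi (s i)].
have f_inj : injective f.
  move=> phi psi /ffunP fE; apply/ffunP => i.
  by have := fE (s^-1%g i); rewrite !ffunE permKV.
rewrite /clique_density /hom_density /avg [in RHS](reindex_inj f_inj) /=.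
congr (_ / _); apply: eq_bigr => phi _; congr (_%:R); congr nat_of_bool.
apply/hom_onP/hom_onP => h.
  move=> i j iS jS ij; rewrite !ffunE; apply: h; rewrite ?imset_f //=.
  by rewrite (inj_eq perm_inj).
move=> _ _ /imsetP[i iS ->] /imsetP[j jS ->] ij.
by have := h i j iS jS; rewrite !ffunE; apply; apply: contraNneq ij => /= ->.
Qed.

Lemma clique_densityD1 S i j : i \in S -> j \in S ->
  clique_density (S :\ i) = clique_density (S :\ j).
Proof.
move=> iS jS; rewrite -(clique_density_perm (tperm i j)); congr clique_density.
apply/setP => k; rewrite -{1}(tpermK i j k) mem_imset ?inE; last exact: perm_inj.
case: tpermP => [->|->|/eqP ki /eqP kj]; rewrite ?eqxx ?iS ?jS /= ?andbT ?andbF //.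
- by rewrite eq_sym.
- by rewrite ki kj.
Qed.

Lemma moon_moser S j z : j \in S -> z \notin S ->
  #|S|%:R * clique_density S ^+ 2 <=
  clique_density (S :\ j) * (clique_density S + #|S|.-1%:R * clique_density (z |: S)).
Proof.
move=> jS zS.
apply: le_trans (_ : clique_density (S :\ j) * \sum_(i in S) cherry_density S i z <= _).
  rewrite mulr_sumr mulr_natl -sumr_const; apply: ler_sum => i iS.
  by rewrite (@clique_densityD1 S j i) // cherry_ge.
by rewrite ler_wpM2l ?clique_ge0 ?cherry_sum_le.
Qed.

End MoonMoser.

(* [t k] stands for the density of k-cliques and [mm] is the Moon-Moser        *)
(* inequality; in the Turan graph [t k] is [1 - (k-1)/r] times [t (k-1)]. Read *)
(* upwards, [mm] propagates the lower bound on edges to larger cliques; read   *)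
(* downwards, it propagates the scarcity of (r+1)-cliques to triangles.        *)
Section CliqueRatios.
Local Open Scope ring_scope.
Variables (R : realFieldType) (r : nat) (t : nat -> R) (g : R).
Hypotheses (r_gt1 : (1 < r)%N) (t1 : t 1 = 1) (t_ge0 : forall k, 0 <= t k).
Hypothesis mm : forall k, (0 < k <= r)%N ->
  k%:R * t k ^+ 2 <= t k.-1 * (t k + k.-1%:R * t k.+1).
Hypotheses (g_small : g * (2 * r%:R ^+ 2) <= 1) (g_ge0 : 0 <= g).
Hypothesis t2 : 1 - r%:R^-1 - g <= t 2.

Let r_gt0 : 0 < r%:R :> R. Proof. by rewrite ltr0n; lia. Qed.
Let turan_ratio k : R := 1 - k.-1%:R / r%:R.

(** For the ratios [x_k = t k / t k.-1], [mm] is the affine recursion [k x_k <= 1 + (k-1) x_(k+1)],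
    with equality at the Turan ratios. An initial error [g] thus grows to [(k-1) g]. Positivity is
    carried along because the recursion divides by it. *)
Lemma clique_ratio_ge k : (1 < k <= r)%N ->
  0 < t k.-1 /\ (turan_ratio k - k.-1%:R * g) * t k.-1 <= t k.
Proof.
elim: k => // k IHk /andP[]; rewrite ltnS leq_eqVlt => /predU1P[<-|k_gt1] kr.
  by rewrite /= t1 ltr01 /turan_ratio /= !mul1r mulr1.
have [|t_gt0 t_le] := IHk; first by rewrite k_gt1 ltnW.
have kR : k.-1%:R + 1 = k%:R :> R by rewrite natr1 prednK //; lia.
have k_le : k.-1%:R <= r%:R - 1 - 1 :> R.
  by rewrite !lerBrDr !natr1 ler_nat; lia.
have k0 : 0 < k.-1%:R :> R by rewrite ltr0n; lia.
have c_ge : (2 * r%:R)^-1 <= turan_ratio k - k.-1%:R * g.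
  rewrite /turan_ratio -(ler_pM2r (_ : 0 < 2 * r%:R ^+ 2)); last by nra.
  rewrite (_ : (2 * r%:R)^-1 * _ = r%:R); last by field; lra.
  rewrite (_ : _ * _ = 2 * r%:R ^+ 2 - 2 * k.-1%:R * r%:R - k.-1%:R * (g * (2 * r%:R ^+ 2)));
    last by field; lra.
  have h1 := mulr_ge0 (ltW k0) (_ : 0 <= 1 - g * (2 * r%:R ^+ 2)).
  have h2 := mulr_ge0 (ltW r_gt0) (_ : 0 <= r%:R - 1 - 1 - k.-1%:R).
  by move: h1 h2; rewrite !subr_ge0 => /(_ g_small) h1 /(_ k_le) h2; nra.
have tk_gt0 : 0 < t k.
  apply: lt_le_trans t_le; rewrite mulr_gt0 //; apply: lt_le_trans c_ge.
  by rewrite invr_gt0; nra.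
have mmk : _ <= _ := mm (introT andP (conj (ltnW k_gt1) (ltnW kr))); split=> //=.
have {mmk} : t k.-1 * (k%:R * ((turan_ratio k - k.-1%:R * g) * t k)) <=
     t k.-1 * (t k + k.-1%:R * t k.+1).
  apply: le_trans mmk; rewrite expr2 !mulrA -[t k.-1 * _ * _]mulrA.
  rewrite ler_pM2r // mulrC -mulrA ler_wpM2l ?ler0n //.
rewrite ler_pM2l // => mmk; rewrite -(ler_pM2l k0) -(lerD2l (t k)).
apply: le_trans mmk; rewrite le_eqVlt; apply/orP; left; apply/eqP.
by rewrite /turan_ratio /= -kR; field; lra.
Qed.

(** For [k <= r] the Turan ratios are at least [1/r], and [g_small] limits the error to half of
    that, so each ratio is at least [1/(2r)]. *)
Lemma clique_lower k : (k <= r)%N -> (0 < k)%N -> (2 * r%:R)^-1 ^+ k <= t k.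
Proof.
have r_ge2 : 2 <= r%:R :> R by rewrite ler_nat.
have i_ge0 : 0 <= (2 * r%:R)^-1 :> R by rewrite invr_ge0; lra.
elim: k => // k IHk kr _; case: (posnP k) => [->|k_gt0].
  by rewrite t1 expr1 invf_le1; lra.
have [|t_gt0 t_le] := @clique_ratio_ge k.+1; first by lia.
have k_le : k%:R <= r%:R - 1 :> R by rewrite lerBrDr natr1 ler_nat; lia.
have k0 : 0 < k%:R :> R by rewrite ltr0n.
apply: le_trans t_le; rewrite exprS /= ler_pM ?exprn_ge0 ?IHk ?(ltnW kr) //.
rewrite /turan_ratio /= -(ler_pM2r (_ : 0 < 2 * r%:R ^+ 2)); last by nra.
rewrite (_ : (2 * r%:R)^-1 * _ = r%:R); last by field; lra.
rewrite (_ : _ * _ = 2 * r%:R ^+ 2 - 2 * k%:R * r%:R - k%:R * (g * (2 * r%:R ^+ 2)));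
  last by field; lra.
have h1 := mulr_ge0 (ltW k0) (_ : 0 <= 1 - g * (2 * r%:R ^+ 2)).
have h2 := mulr_ge0 (ltW r_gt0) (_ : 0 <= r%:R - 1 - k%:R).
by move: h1 h2; rewrite !subr_ge0 => /(_ g_small) h1 /(_ k_le) h2; nra.
Qed.

(** The same recursion read from [r.+1] down. There the Turan ratio is 0 and [clique_lower] gives
    [t r.+1 / t r <= g (2r)^r]. Going down, the error is multiplied by [(k-1)/k], so it does not
    grow. *)
Lemma clique_ratio_le k : t r.+1 <= g -> (1 < k <= r.+1)%N ->
  t k <= (turan_ratio k + g * (2 * r%:R) ^+ r) * t k.-1.
Proof.
move=> tr; move: k; suff H m k : (r.+1 - k = m)%N -> (1 < k <= r.+1)%N ->
  t k <= (turan_ratio k + g * (2 * r%:R) ^+ r) * t k.-1 by move=> k; apply: H.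
set th := g * _; have th_ge0 : 0 <= th.
  by rewrite mulr_ge0 // exprn_ge0 // mulr_ge0 // ltW.
elim: m k => [|m IHm] k km kr.
  have -> : k = r.+1 by lia.
  rewrite /turan_ratio /= divff ?gt_eqF // subrr add0r.
  apply: le_trans tr _; rewrite /th -mulrA ler_peMr //.
  have := clique_lower (leqnn r); rewrite exprVn => /(_ ltac:(lia)) h.
  by rewrite -ler_pdivrMl ?mulr1 // exprn_gt0 // mulr_gt0.
have [k_gt1 k_gt0 kr' km'] : [/\ (1 < k)%N, (0 < k)%N, (k <= r)%N & (r.+1 - k.+1 = m)%N].
  by move: kr km; clear; split; lia.
have := IHm k.+1 km' ltac:(rewrite ltnS k_gt0 ltnS; exact: kr'); rewrite /= => tk.
have [t_gt0 _] := @clique_ratio_ge k (introT andP (conj k_gt1 kr')).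
have tk_gt0 : 0 < t k.
  apply: lt_le_trans (_ : (2 * r%:R)^-1 ^+ k <= _); last exact: clique_lower.
  by rewrite exprn_gt0 // invr_gt0 mulr_gt0.
have kR : k.-1%:R + 1 = k%:R :> R by rewrite natr1 prednK //; lia.
have k0 : 0 < k.-1%:R :> R by rewrite ltr0n; lia.
have mmk : _ <= _ := mm (introT andP (conj k_gt0 kr')).
have {mmk} : t k * (k%:R * t k) <=
   t k * (k%:R * ((turan_ratio k + th) * t k.-1)).
  rewrite mulrCA -expr2; apply: le_trans mmk _.
  apply: le_trans (_ : t k.-1 * (t k + k.-1%:R * ((turan_ratio k.+1 + th) * t k)) <= _).
    by rewrite ler_pM2l // lerD2l ler_pM2l.
  rewrite -subr_ge0 (_ : _ - _ = t k * t k.-1 * th).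
    by apply: mulr_ge0 => //; apply: mulr_ge0.
  by rewrite /turan_ratio /= -kR; field; apply: lt0r_neq0.
by rewrite ler_pM2l // ler_pM2l // -kR; lra.
Qed.

End CliqueRatios.

(** * Stability *)

Section DegreesOfCliques.
Local Open Scope ring_scope.
Variables (R : realFieldType) (I W : finType) (e : rel W).
Hypotheses (e_sym : symmetric e) (W_gt0 : (0 < #|W|)%N).
Implicit Types (phi : {ffun I -> W}) (i j z : I) (v w : W) (S T : {set I}).

Let n : R := #|W|%:R.
Let n_gt0 : 0 < n. Proof. by rewrite ltr0n. Qed.

Lemma avg_coord i (G : W -> R) : avg (fun phi => G (phi i)) = (\sum_w G w) / n.
Proof.
rewrite (avg_upd W_gt0 i) -[RHS](avg_cst I W_gt0); apply: eq_avg => phi.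
by congr (_ / _); apply: eq_bigr => w _; rewrite updE eqxx.
Qed.

Definition rdeg w : R := (\sum_v (e w v)%:R) / n.

Lemma hom_on1 S phi : (#|S| <= 1)%N -> hom_on e id S phi.
Proof.
move=> /card_le1_eqP S1; apply/hom_onP => i j iS jS.
by rewrite (S1 i j) // eqxx.
Qed.

Lemma clique_density1 S : (#|S| <= 1)%N -> clique_density R e S = 1.
Proof.
move=> S1; rewrite -[RHS](avg_cst I W_gt0); apply: eq_avg => phi.
by rewrite hom_on1.
Qed.

Lemma sees1 j phi w : sees e [set j] phi w = e (phi j) w.
Proof.
apply/forall_inP/idP => [|jw i /set1P -> //]; by apply; rewrite set11.
Qed.

Lemma clique_density2 i j : i != j ->
  clique_density R e [set i; j] = (\sum_w rdeg w) / n.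
Proof.
move=> ij; rewrite -(avg_coord j) /clique_density /hom_density.
rewrite [LHS](avg_upd W_gt0 i); apply: eq_avg => phi.
rewrite /rdeg; congr (_ / _); apply: eq_bigr => w _.
rewrite (@hom_on_cliqueU1 _ _ e) ?in_set1 // hom_on1 ?cards1 //= sees1 !updE eqxx.
by rewrite eq_sym (negPf ij).
Qed.

Lemma cherry_density2 i j z : i != j -> z != i -> z != j ->
  cherry_density R e [set i; j] i z = (\sum_w rdeg w ^+ 2) / n.
Proof.
move=> ij zi zj; rewrite -(avg_coord j) /cherry_density.
have -> : [set i; j] :\ i = [set j] by rewrite setU1K // in_set1.
transitivity (avg (fun phi => (e (phi j) (phi i))%:R * rdeg (phi j))).
  rewrite [LHS](avg_upd W_gt0 z); apply: eq_avg => phi.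
  rewrite /rdeg mulrA mulr_sumr; congr (_ / _); apply: eq_bigr => w _.
  rewrite hom_on1 ?cards1 // mul1r !sees1 !updE eqxx.
  by rewrite ![_ == z]eq_sym (negPf zi) (negPf zj).
rewrite [LHS](avg_upd W_gt0 i); apply: eq_avg => phi.
transitivity ((\sum_w (e (phi j) w)%:R * rdeg (phi j)) / n).
  congr (_ / _); apply: eq_bigr => w _; rewrite !updE eqxx.
  by rewrite [_ == i]eq_sym (negPf ij).
by rewrite -mulr_suml mulrAC.
Qed.

(** For an edge, a cherry is a path on three vertices, so the cherry bound controls the sum of
    squared degrees. With few triangles it will bound the variance of the degrees. *)
Lemma degree_second_moment i j z : i != j -> z != i -> z != j ->
  2 * ((\sum_w rdeg w ^+ 2) / n) <=
  clique_density R e [set i; j] + clique_density R e (z |: [set i; j]).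
Proof.
move=> ij zi zj.
have zS : z \notin [set i; j] by rewrite !inE (negPf zi) (negPf zj).
have := @cherry_sum_le R I W e e_sym [set i; j] z zS.
rewrite cards2 ij mul1r big_setU1 ?in_set1 //= big_set1.
rewrite {2}[ [set i; j] ]setUC !cherry_density2 //; try by rewrite eq_sym.
by rewrite mulr_natl.
Qed.

End DegreesOfCliques.

(** * The partition defined by a single clique *)

Section StabilityFromClique.
Local Open Scope ring_scope.
Variables (R : realFieldType) (I W : finType) (e : rel W) (S : {set I}) (z : I).
Hypotheses (e_sym : symmetric e) (W_gt0 : (0 < #|W|)%N) (zS : z \notin S).
Implicit Types (phi : {ffun I -> W}) (i j : I) (v w : W).

Let n : R := #|W|%:R.
Let n_gt0 : 0 < n. Proof. by rewrite ltr0n. Qed.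

Lemma seesD1 i phi w : i \in S ->
  sees e S phi w = e (phi i) w && sees e (S :\ i) phi w.
Proof.
move=> iS; apply/forall_inP/andP => [h|[iw /forall_inP h] j jS].
  by split; [apply: h | apply/forall_inP => j /setD1P[_ jS]; apply: h].
by have [->//|ji] := eqVneq j i; apply: h; rewrite !inE ji.
Qed.

Definition extensions phi : R := \sum_v (sees e S phi v)%:R.

Definition twin_edges phi i : R :=
  \sum_v \sum_w [&& e v w, sees e (S :\ i) phi v & sees e (S :\ i) phi w]%:R.

Lemma avg_extensions :
  avg (fun phi => (hom_on e id S phi)%:R * (extensions phi / n)) =
  clique_density R e (z |: S).
Proof.
rewrite /clique_density /hom_density [RHS](avg_upd W_gt0 z); apply: eq_avg => phi.
rewrite mulrA mulr_sumr; congr (_ / _); apply: eq_bigr => w _.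
by rewrite hom_on_cliqueU1 // hom_on_upd // sees_upd // updE eqxx -mulnb natrM.
Qed.

(** A twin edge together with the clique on [S :\ i] is a clique with one vertex more than [S],
    hence rare. *)
Lemma avg_twin_edges i : i \in S ->
  avg (fun phi => (hom_on e id S phi)%:R * (twin_edges phi i / n ^+ 2)) <=
  clique_density R e (z |: S).
Proof.
move=> iS; have iz : i != z by apply: contraNneq zS => <-.
have iN : i \notin S :\ i by rewrite !inE eqxx.
have zN : z \notin S :\ i by rewrite !inE (negPf zS) andbF.
apply: le_trans (_ : avg (fun phi => (hom_on e id (S :\ i) phi)%:R *
    (twin_edges phi i / n ^+ 2)) <= _).
  apply: ler_avg => phi; rewrite ler_wpM2r //.
    by rewrite divr_ge0 ?sumr_ge0 ?exprn_ge0 ?ler0n // => v _; rewrite sumr_ge0.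
  by rewrite (hom_on_cliqueD1 e_sym phi iS) ler_nat; case: hom_on; case: sees.
rewrite le_eqVlt; apply/orP; left; apply/eqP.
rewrite /clique_density /hom_density [RHS](avg_upd W_gt0 i).
rewrite [RHS](avg_upd W_gt0 z); apply: eq_avg => phi.
rewrite expr2 invfM !mulrA; congr (_ / _); rewrite -[RHS]mulr_suml; congr (_ / _).
rewrite mulr_sumr exchange_big /=; apply: eq_bigr => v _; rewrite mulr_sumr.
apply: eq_bigr => w _; rewrite -natrM mulnb; congr (_%:R); congr nat_of_bool.
rewrite hom_on_cliqueU1 // (@hom_on_cliqueD1 _ _ e e_sym S i) //.
rewrite (seesD1 _ _ iS) !hom_on_upd // !sees_upd // !updE eqxx [z == i]eq_sym.
by rewrite (negPf iz) eqxx; do !bool_congr; rewrite andbCA.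
Qed.

Let r := #|S|.
Let dev w : R := `|rdeg R e w - (1 - r%:R^-1)|.

(* Class [i] of the partition consists of the vertices adjacent to all of the *)
(* clique [phi @: S] but [phi i]; few vertices have another adjacency pattern *)
(* when [phi] has few extensions and almost regular degrees.                  *)
Lemma partition_from_clique phi i0 : i0 \in S -> hom_on e id S phi ->
  exists2 p : W -> I, (forall v, p v \in S) &
    \sum_v \sum_w (e v w && (p v == p w))%:R <=
    n ^+ 2 * (\sum_(i in S) twin_edges phi i / n ^+ 2 +
       2 * (2 * (extensions phi / n) + \sum_(i in S) dev (phi i))).
Proof.
move=> i0S phiS.
(* [p v] is a member of the clique not adjacent to [v]. The default [i0] serves only vertices
   adjacent to the whole clique, which are exceptional. *)
pose p v := odflt i0 [pick i in S | ~~ e (phi i) v].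
pose exc v := ~~ [exists i in S, ~~ e (phi i) v && sees e (S :\ i) phi v].
have pE v : ~~ exc v -> p v \in S /\ sees e (S :\ p v) phi v.
  rewrite negbK => /exists_inP[i iS /andP[niv siv]].
  suff -> : p v = i by [].
  rewrite /p; case: pickP => [j /andP[jS njv]|/(_ i)]; last by rewrite iS niv.
  apply: contraNeq njv => /= ji; apply: (forall_inP siv).
  by rewrite !inE ji.
exists p => [v|].
  by rewrite /p; case: pickP => // j /andP[].
have excS : \sum_v (exc v)%:R <= 2 * extensions phi + n * \sum_(i in S) dev (phi i).
  have r_neq0 : r%:R != 0 :> R by rewrite pnatr_eq0 -lt0n /r (cardsD1 i0) i0S.
  (* Count non-neighbours in the clique: an ordinary vertex has one, an exceptional vertex has two
     or more unless it has none, the case covered by the last term. If the clique has almost regular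
     degrees, the total is about [n] and cancels the sum of the 1s. *)
  have pt v : (exc v)%:R + 1 <=
      \sum_(i in S) (~~ e (phi i) v)%:R + 2 * (sees e S phi v)%:R :> R.
    have [sv|/forall_inPn[i iS niv]] := boolP (sees e S phi v).
      have : 0 <= \sum_(i in S) (~~ e (phi i) v)%:R :> R by rewrite sumr_ge0.
      by case: (exc v) => /=; lra.
    rewrite (bigD1 i) //= niv.
    have [/exists_inPn/(_ i iS)|_] := boolP (exc v); last first.
      by have : 0 <= \sum_(j in S | j != i) (~~ e (phi j) v)%:R :> R;
        [rewrite sumr_ge0 | rewrite /=; lra].
    rewrite niv /= => /forall_inPn[j /setD1P[ji jS] njv].
    rewrite (bigD1 j) ?jS //= njv.
    by have : 0 <= \sum_(k | (k \in S) && (k != i) && (k != j)) (~~ e (phi k) v)%:R :> R;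
        [rewrite sumr_ge0 | rewrite /=; lra].
  have {pt} : \sum_v ((exc v)%:R + 1) <= \sum_v (\sum_(i in S) (~~ e (phi i) v)%:R +
      2 * (sees e S phi v)%:R) :> R by apply: ler_sum => v _.
  rewrite !big_split /= sumr_const -mulr_sumr -/(extensions phi) exchange_big /=.
  have -> : \sum_(i in S) \sum_v (~~ e (phi i) v)%:R =
      n * \sum_(i in S) (1 - rdeg R e (phi i)).
    rewrite mulr_sumr; apply: eq_bigr => i _.
    rewrite (eq_bigr (fun v => 1 - (e (phi i) v)%:R)) => [|v _]; last first.
      by case: (e _ _); rewrite ?subr0 ?subrr.
    by rewrite sumrB sumr_const /rdeg -/n; field; rewrite gt_eqF.
  move=> excS.
  have : \sum_(i in S) (1 - rdeg R e (phi i)) <= \sum_(i in S) (r%:R^-1 + dev (phi i)).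
    apply: ler_sum => i _; have := ler_norm (- (rdeg R e (phi i) - (1 - r%:R^-1))).
    by rewrite normrN -/(dev _); lra.
  rewrite [\sum_(i in S) (_^-1 + _)]big_split /= sumr_const.
  rewrite -[_^-1 *+ #|_|]mulr_natl divff //.
  by rewrite -(ler_pM2l n_gt0); move: excS; rewrite -/n; lra.
apply: le_trans (_ : \sum_v \sum_w (\sum_(i in S)
   ([&& e v w, sees e (S :\ i) phi v & sees e (S :\ i) phi w]%:R) +
   ((exc v)%:R + (exc w)%:R)) <= _).
  apply: ler_sum => v _; apply: ler_sum => w _.
  have s0 : 0 <= \sum_(i in S) ([&& e v w, sees e (S :\ i) phi v &
    sees e (S :\ i) phi w]%:R) :> R by rewrite sumr_ge0.
  case: andP => [[vw /eqP pvw]|_]; last by rewrite !addr_ge0.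
  have [ev|/pE[pvS sv]] := boolP (exc v); first by case: (exc w) => /=; lra.
  have [ew|/pE[_ sw]] := boolP (exc w); first by rewrite /=; lra.
  rewrite (bigD1 (p v)) //= vw sv pvw sw /= !addr0 lerDl sumr_ge0 //.
have -> : \sum_v \sum_w (\sum_(i in S)
   ([&& e v w, sees e (S :\ i) phi v & sees e (S :\ i) phi w]%:R) +
   ((exc v)%:R + (exc w)%:R)) =
   \sum_(i in S) twin_edges phi i + 2 * n * \sum_v (exc v)%:R :> R.
  rewrite (eq_bigr (fun v => \sum_(i in S) \sum_w
     [&& e v w, sees e (S :\ i) phi v & sees e (S :\ i) phi w]%:R +
     (n * (exc v)%:R + \sum_w (exc w)%:R))) => [|v _].
    rewrite !big_split /= exchange_big /= -mulr_sumr sumr_const -[_ *+ #|_|]mulr_natl.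
    by rewrite -/n; ring.
  by rewrite big_split exchange_big big_split sumr_const /= -[_ *+ #|_|]mulr_natl.
rewrite mulrDr; apply: lerD.
  by rewrite mulr_sumr; apply: ler_sum => i _; rewrite mulrC divfK // expf_neq0 ?gt_eqF.
rewrite -(ler_pM2l (_ : 0 < 2 * n)) in excS; last by rewrite mulr_gt0.
apply: le_trans excS _; rewrite le_eqVlt; apply/orP; left; apply/eqP.
by field; rewrite gt_eqF.
Qed.

End StabilityFromClique.

Section Stability.
Local Open Scope ring_scope.
Variables (R : realFieldType) (r : nat).
Hypothesis r_gt1 : (1 < r)%N.

Section Fixed.
Variables (I W : finType) (e : rel W) (S0 : {set I}) (g lam eps : R).
Hypotheses (e_sym : symmetric e) (W_gt0 : (0 < #|W|)%N) (S0_card : #|S0| = r.+1).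
Let n : R := #|W|%:R.
Hypotheses (g_ge0 : 0 <= g) (g_small : g * (2 * r%:R ^+ 2) <= 1).
Hypothesis edges_ge : 1 - r%:R^-1 - g <= (\sum_w \sum_v (e w v)%:R) / n ^+ 2.
Hypothesis cliques_le : clique_density R e S0 <= g.
Hypotheses (eps_gt0 : 0 < eps) (lam_gt0 : 0 < lam) (g_lam : g * (1 + (2 * r%:R) ^+ r) <= lam ^+ 2).
Hypothesis eps_ge : (r%:R + 4) * g + 4 * r%:R * lam < eps * (2 * r%:R)^-1 ^+ r.

Let n_gt0 : 0 < n. Proof. by rewrite ltr0n. Qed.
Let r_gt0 : 0 < r%:R :> R. Proof. by rewrite ltr0n ltnW. Qed.

Let l := enum S0.
Let x0 : I.
Proof.
case: (pickP [in S0]) => [x _|S00]; first exact: x.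
by exfalso; move: S0_card; rewrite eq_card0.
Qed.
Let S k := [set x in take k l].
Let a k := nth x0 l k.
Let t k := clique_density R e (S k).

Let l_size : size l = r.+1. Proof. by rewrite -cardE. Qed.

Let aS k : (k <= r)%N -> a k \notin S k.
Proof.
move=> kr; rewrite inE; have : uniq (take k l ++ drop k l).
  by rewrite cat_take_drop enum_uniq.
rewrite (drop_nth x0) ?l_size ?ltnS // cat_uniq => /and3P[_ + _].
by rewrite /= negb_or => /andP[].
Qed.

Let S_succ k : (k <= r)%N -> S k.+1 = a k |: S k.
Proof.
move=> kr; apply/setP => x; rewrite !inE (take_nth x0) ?l_size ?ltnS //.
by rewrite mem_rcons inE.
Qed.

Let S_card k : (k <= r.+1)%N -> #|S k| = k.
Proof.
elim: k => [_|k IHk kr]; last by rewrite S_succ // cardsU1 aS // IHk // ltnW.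
by apply/eqP; rewrite cards_eq0; apply/eqP/setP => x; rewrite !inE take0.
Qed.

Let S_last : S r.+1 = S0.
Proof. by apply/setP => x; rewrite inE -l_size take_size mem_enum. Qed.

Let t1 : t 1 = 1. Proof. by apply: clique_density1; rewrite ?S_card. Qed.

Let mm k : (0 < k <= r)%N ->
  k%:R * t k ^+ 2 <= t k.-1 * (t k + k.-1%:R * t k.+1).
Proof.
case: k => // k /= kr; have jS : a k \in S k.+1 by rewrite S_succ ?setU11 // ltnW.
have := @moon_moser R I W e e_sym W_gt0 _ _ (a k.+1) jS (aS kr).
by rewrite S_card 1?ltnW // -S_succ // {2}S_succ 1?ltnW // setU1K ?aS // ltnW.
Qed.

Let S2 : S 2 = [set a 0; a 1].
Proof.
have S1 : S 1 = a 0 |: S 0 by apply: S_succ.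
have -> : S 2 = a 1 |: S 1 by apply: S_succ; apply: ltnW.
by rewrite S1; apply/setP => x; rewrite !inE take0 in_nil orbF orbC.
Qed.

Let a01 : a 0 != a 1.
Proof. by have := S_card (ltnW r_gt1 : 2 <= r.+1)%N; rewrite S2 cards2; case: eqP. Qed.

Let t2E : t 2 = (\sum_w rdeg R e w) / n.
Proof. by rewrite /t S2 clique_density2. Qed.

Let t2_ge : 1 - r%:R^-1 - g <= t 2.
Proof.
apply: le_trans edges_ge _; rewrite t2E /rdeg -mulr_suml expr2 invfM mulrA.
by rewrite -/n.
Qed.

Let dev w : R := `|rdeg R e w - (1 - r%:R^-1)|.

Let avg_dev i : avg (fun phi : {ffun I -> W} => dev (phi i)) <= 2 * lam.
Proof.
pose b : R := 1 - r%:R^-1; rewrite avg_coord //.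
have b01 : 0 <= b <= 1.
  by rewrite subr_ge0 invf_le1 // ler1n (ltnW r_gt1) gerBl invr_ge0 ltW.
have m2 : 2 * ((\sum_w rdeg R e w ^+ 2) / n) <= t 2 + t 3.
  have a2 : a 2 \notin S 2 by rewrite aS.
  rewrite /t (@S_succ 2) // S2; apply: degree_second_moment => //.
  - by move: a2; rewrite S2 !inE negb_or => /andP[].
  - by move: a2; rewrite S2 !inE negb_or => /andP[].
have t3 : t 3 <= (1 - 2 / r%:R + g * (2 * r%:R) ^+ r) * t 2.
  apply: (clique_ratio_le r_gt1 t1 _ mm g_small g_ge0 t2_ge) => //.
  - by move=> k; apply: clique_ge0.
  - by rewrite /t S_last.
(* The second moment is at most [(t 2 + t 3) / 2], and [t 3 <= (2 b - 1 + th) t 2]; so the variance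
   is at most [b (b - t 2) + th / 2], and [b - t 2 <= g]. *)
have v_le : (\sum_w (rdeg R e w - b) ^+ 2) / n <= lam ^+ 2.
  have -> : (\sum_w (rdeg R e w - b) ^+ 2) / n =
      (\sum_w rdeg R e w ^+ 2) / n - 2 * b * t 2 + b ^+ 2.
    rewrite (eq_bigr (fun w => rdeg R e w ^+ 2 + (- (2 * b) * rdeg R e w + b ^+ 2)));
      last by move=> w _; ring.
    rewrite !big_split /= -mulr_sumr sumr_const -[_ *+ #|_|]mulr_natl t2E -/n.
    by field; rewrite gt_eqF.
  apply: le_trans g_lam.
  have := @clique_le1 R I W e W_gt0 (S 2) : t 2 <= 1.
  set th := g * (2 * r%:R) ^+ r in t3 *.
  have th_ge0 : 0 <= th by rewrite mulr_ge0 // exprn_ge0 // mulr_ge0 // ltW.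
  have t20 : 0 <= t 2 by apply: clique_ge0.
  move=> t21; case/andP: b01 => b0 b1.
  have h1 : 0 <= b * (g - (b - t 2)) by rewrite mulr_ge0 // subr_ge0; move: t2_ge; rewrite -/b; lra.
  have h2 : 0 <= g * (1 - b) by rewrite mulr_ge0 ?subr_ge0.
  have h3 : 0 <= th * (1 - t 2) by rewrite mulr_ge0 ?subr_ge0.
  rewrite [g * (1 + _)]mulrDr mulr1 -/th; move: m2 t3.
  rewrite (_ : 1 - 2 / r%:R = 2 * b - 1); last by rewrite /b; ring.
  by move=> m2 t3; lra.
(* Pointwise [|y| <= lam + y ^+ 2 / lam], which passes from the variance to the mean deviation
   without a square root. *)
apply: le_trans (_ : lam + ((\sum_w (rdeg R e w - b) ^+ 2) / n) / lam <= _); last first.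
  rewrite (_ : 2 * lam = lam + lam); last by ring.
  by rewrite lerD2l ler_pdivrMr // -expr2.
apply: le_trans (_ : (\sum_w (lam + (rdeg R e w - b) ^+ 2 / lam)) / n <= _); last first.
  rewrite big_split /= sumr_const -mulr_suml -[_ *+ #|_|]mulr_natl -/n.
  by rewrite le_eqVlt; apply/orP; left; apply/eqP; field; rewrite !gt_eqF.
rewrite ler_pM2r ?invr_gt0 //; apply: ler_sum => w _.
rewrite -(ler_pM2r lam_gt0) mulrDl divfK ?gt_eqF //.
rewrite /dev -/b -[(_ - b) ^+ 2]ger0_norm ?sqr_ge0 // normrX.
have := normr_ge0 (rdeg R e w - b); nra.
Qed.

Lemma stability_fixed :
  exists p : W -> 'I_r, \sum_v \sum_w (e v w && (p v == p w))%:R <= eps * n ^+ 2.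
Proof.
have zS : a r \notin S r by apply: aS.
have S_card_r : #|S r| = r by rewrite S_card.
have SE : a r |: S r = S0 by rewrite -S_succ.
pose Y (phi : {ffun I -> W}) := \sum_(i in S r) twin_edges R e (S r) phi i / n ^+ 2 +
  2 * (2 * (extensions R e (S r) phi / n) + \sum_(i in S r) dev (phi i)).
(* Over the r-cliques [Y] sums to at most [(r + 4) g + 4 r lam] in density, while these cliques have
   density at least [(2r)^(-r)]; by [eps_ge] one of them has [Y phi <= eps]. *)
have [phi phiS Yphi] : exists2 phi, hom_on e id (S r) phi & Y phi <= eps.
  apply/exists_inP; rewrite -[X in is_true X]negbK; apply/negP => /exists_inPn noY.
  have : avg (fun phi => (hom_on e id (S r) phi)%:R * Y phi) <=
      (r%:R + 4) * g + 4 * r%:R * lam.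
    rewrite (eq_avg (h := fun phi => \sum_(i in S r)
        (hom_on e id (S r) phi)%:R * (twin_edges R e (S r) phi i / n ^+ 2) +
      (4 * ((hom_on e id (S r) phi)%:R * (extensions R e (S r) phi / n)) +
       2 * \sum_(i in S r) (hom_on e id (S r) phi)%:R * dev (phi i)))); last first.
      by move=> phi; rewrite /Y -!mulr_sumr; ring.
    rewrite !avgD !avgZ !avg_sum (avg_extensions R e_sym W_gt0 zS) SE.
    have twin_le : \sum_(i in S r) avg (fun phi => (hom_on e id (S r) phi)%:R *
        (twin_edges R e (S r) phi i / n ^+ 2)) <= r%:R * g.
      have -> : r%:R * g = \sum_(i in S r) g by rewrite sumr_const S_card_r mulr_natl.
      apply: ler_sum => i iS.
      by apply: le_trans cliques_le; rewrite -SE; apply: avg_twin_edges.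
    have dev_le : \sum_(i in S r) avg (fun phi => (hom_on e id (S r) phi)%:R *
        dev (phi i)) <= r%:R * (2 * lam).
      have -> : r%:R * (2 * lam) = \sum_(i in S r) (2 * lam).
        by rewrite sumr_const S_card_r -[RHS]mulr_natl.
      apply: ler_sum => i iS.
      apply: le_trans (avg_dev i); apply: ler_avg => phi.
      by rewrite ler_piMl ?normr_ge0 ?lern1 ?leq_b1.
    by move: cliques_le; lra.
  apply/negP; rewrite -ltNge; apply: lt_le_trans eps_ge _.
  apply: le_trans (_ : eps * t r <= _).
    rewrite ler_pM2l //; apply: (clique_lower r_gt1 t1 mm g_small g_ge0 t2_ge) => //.
    by rewrite ltnW.
  rewrite -avgZ; apply: ler_avg => phi; rewrite mulrC.
  have := noY phi; rewrite -topredE /=; case: hom_on => [/(_ isT)|_]; last by rewrite !mul0r.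
  by rewrite !mul1r -ltNge => /ltW.
have [i0 i0S] : exists i0, i0 \in S r by apply/card_gt0P; rewrite S_card_r ltnW.
have [p pS pE] := partition_from_clique R W_gt0 i0S phiS.
pose k i : 'I_r := insubd (Ordinal (ltnW r_gt1)) (index i (enum (S r))).
have kE i : i \in S r -> val (k i) = index i (enum (S r)).
  move=> iS; rewrite /k val_insubd ifT //.
  by rewrite -[X in (_ < X)%N]S_card_r cardE index_mem mem_enum.
exists (k \o p); apply: le_trans (_ : n ^+ 2 * Y phi <= _); last first.
  by rewrite mulrC ler_pM2r // exprn_gt0.
apply: le_trans _ (le_trans pE _); last by rewrite S_card_r.
apply: ler_sum => v _; apply: ler_sum => w _; rewrite ler_nat.
case: (e v w) => //=; rewrite (_ : (k (p v) == k (p w)) = (p v == p w)) //.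
apply/eqP/eqP => [/(congr1 val)|-> //]; rewrite !kE // => /(congr1 (nth i0 (enum (S r)))).
by rewrite !nth_index ?mem_enum.
Qed.

End Fixed.

Lemma stability (eps : R) : 0 < eps -> exists2 g : R, 0 < g &
  forall (I W : finType) (e : rel W) (S0 : {set I}), symmetric e -> (0 < #|W|)%N ->
    #|S0| = r.+1 ->
    1 - r%:R^-1 - g <= (\sum_w \sum_v (e w v)%:R) / #|W|%:R ^+ 2 ->
    clique_density R e S0 <= g ->
  exists p : W -> 'I_r,
    \sum_v \sum_w (e v w && (p v == p w))%:R <= eps * #|W|%:R ^+ 2.
Proof.
move=> eps0; have r0 : 0 < r%:R :> R by rewrite ltr0n ltnW.
set rho := (2 * r%:R : R)^-1 ^+ r.
have rho0 : 0 < rho by rewrite exprn_gt0 // invr_gt0 mulr_gt0.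
have T0 : 0 < (2 * r%:R : R) ^+ r by rewrite exprn_gt0 // mulr_gt0.
pose lam := eps * rho / (8 * r%:R).
have lam0 : 0 < lam by rewrite divr_gt0 ?mulr_gt0.
(* Each [x_i] encodes one smallness condition of [stability_fixed] as [g * x_i <= 1]; the inverse of
   their sum meets all three. *)
pose x1 := 2 * r%:R ^+ 2 : R; pose x2 := (1 + (2 * r%:R) ^+ r) / lam ^+ 2.
pose x3 := 4 * (r%:R + 4) / (eps * rho).
have x10 : 0 < x1 by rewrite mulr_gt0 ?exprn_gt0.
have x20 : 0 < x2 by rewrite divr_gt0 ?exprn_gt0 ?addr_gt0.
have x30 : 0 < x3 by rewrite divr_gt0 ?mulr_gt0 ?addr_gt0.
have x0 : 0 < x1 + x2 + x3 by rewrite !addr_gt0.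
pose g := (x1 + x2 + x3)^-1; have g0 : 0 < g by rewrite invr_gt0.
have gx : g * (x1 + x2 + x3) = 1 by rewrite mulVf ?gt_eqF.
have [gx1 gx2 gx3] : [/\ 0 <= g * x1, 0 <= g * x2 & 0 <= g * x3].
  by split; rewrite mulr_ge0 // ltW.
exists g => // I W e S0 e_sym W0 S0r edges cliques.
apply: (stability_fixed e_sym W0 S0r (ltW g0) _ edges cliques eps0 lam0).
- by move: gx gx2 gx3; rewrite !mulrDr -/x1; lra.
- rewrite -[leRHS]mul1r -ler_pdivrMr ?exprn_gt0 // -mulrA -/x2.
  by move: gx gx1 gx3; rewrite !mulrDr; lra.
have : g * x3 <= 1 by move: gx gx1 gx2; rewrite !mulrDr; lra.
rewrite /x3 mulrA ler_pdivrMr ?mulr_gt0 // mul1r.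
have -> : 4 * r%:R * lam = eps * rho / 2 by rewrite /lam; field; rewrite gt_eqF.
have : 0 < eps * rho by rewrite mulr_gt0.
by rewrite -/rho; lra.
Qed.

End Stability.

(** * Counting maps with two pinned values *)

Section PinnedMaps.
Local Open Scope ring_scope.
Variables (R : realFieldType) (V W : finType).
Hypothesis W_gt0 : (0 < #|W|)%N.
Implicit Types (phi : {ffun V -> W}) (a b s t u v : V) (x y w : W).

Let n : R := #|W|%:R.
Let n_gt0 : 0 < n. Proof. by rewrite ltr0n. Qed.

Lemma avg_card (P : pred {ffun V -> W}) :
  avg (fun phi => (P phi)%:R) = #|[set phi | P phi]|%:R / n ^+ #|V| :> R.
Proof.
rewrite /avg -natr_sum; congr (_%:R / _).
by rewrite -sum1_card [RHS]big_mkcond /=; apply: eq_bigr => phi _; rewrite inE; case: (P phi).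
Qed.

Lemma avg_coord2 s t (G : W -> W -> R) : s != t ->
  avg (fun phi => G (phi s) (phi t)) = (\sum_w \sum_x G w x) / n ^+ 2.
Proof.
move=> st; rewrite (avg_upd W_gt0 t) expr2 invfM mulrA mulr_suml.
rewrite -(avg_coord W_gt0 s); apply: eq_avg => phi; congr (_ / _).
by apply: eq_bigr => w _; rewrite !updE eqxx (negPf st).
Qed.

Lemma avg_pin a x (g : {ffun V -> W} -> R) :
  avg (fun phi => (phi a == x)%:R * g phi) = avg (fun phi => g (upd phi a x)) / n.
Proof.
rewrite (avg_upd W_gt0 a) mulrC -avgZ; apply: eq_avg => phi.
rewrite mulrC; congr (_ * _); rewrite (bigD1 x) //= updE !eqxx mul1r big1 ?addr0 //.
by move=> w wx; rewrite updE eqxx (negPf wx) mul0r.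
Qed.

Lemma avg_pin2 a x b y (g : {ffun V -> W} -> R) : a != b ->
  avg (fun phi => ((phi a == x) && (phi b == y))%:R * g phi) =
  avg (fun phi => g (upd (upd phi b y) a x)) / n ^+ 2.
Proof.
move=> ab; rewrite expr2 invfM mulrA -(avg_pin b y (fun phi => g (upd phi a x))).
rewrite (eq_avg (h := fun phi => (phi a == x)%:R * ((phi b == y)%:R * g phi))); last first.
  by move=> phi; rewrite -mulnb natrM mulrA.
rewrite avg_pin; congr (_ / _); apply: eq_avg => phi.
by rewrite updE [b == a]eq_sym (negPf ab).
Qed.

Section Conflict.
Variable Q : rel W.
Hypothesis Q_sym : symmetric Q.

Definition conflict phi := [exists s, exists t, (s != t) && Q (phi s) (phi t)].

Definition qdeg w : R := \sum_x (Q w x)%:R.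

(** A union bound over the pairs [s, t]: with no pinned end a pair costs the density of [Q], with
    one pinned end the relative degree of [x] or [y], and with both ends pinned nothing, since
    [Q x y] fails. *)
Definition conflict_bound x y : R :=
  #|V|%:R ^+ 2 * ((\sum_w qdeg w) / n ^+ 2 + (qdeg x + qdeg y) / n).

Let qdeg_ge0 w : 0 <= qdeg w. Proof. by rewrite sumr_ge0. Qed.

Lemma avg_conflict_pair a x b y s t : a != b -> s != t -> ~~ Q x y ->
  avg (fun phi => (Q (upd (upd phi b y) a x s) (upd (upd phi b y) a x t))%:R) <=
  (\sum_w qdeg w) / n ^+ 2 + (qdeg x + qdeg y) / n.
Proof.
move=> ab st Qxy.
have e0 : 0 <= (\sum_w qdeg w) / n ^+ 2.
  by rewrite divr_ge0 ?exprn_ge0 ?ler0n ?sumr_ge0.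
have dx : 0 <= qdeg x / n by rewrite divr_ge0 ?ler0n.
have dy : 0 <= qdeg y / n by rewrite divr_ge0 ?ler0n.
have one w i : avg (fun phi => (Q w (phi i))%:R) = qdeg w / n.
  by rewrite (avg_coord W_gt0 i (fun x => (Q w x)%:R)).
rewrite mulrDl; under eq_avg do rewrite !updE.
have [sa|sa] := eqVneq s a; have [ta|ta] := eqVneq t a.
- by move: st; rewrite sa ta eqxx.
- have [tb|tb] := eqVneq t b => /=; last by rewrite one; lra.
  under eq_avg do rewrite (negPf Qxy).
  by rewrite avg_cst // !addr_ge0.
- have [sb|sb] := eqVneq s b => /=; under eq_avg do rewrite Q_sym.
    under eq_avg do rewrite (negPf Qxy).
    by rewrite avg_cst // !addr_ge0.
  by rewrite one; lra.
have [sb|sb] := eqVneq s b; have [tb|tb] := eqVneq t b => /=.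
- by move: st; rewrite sb tb eqxx.
- by rewrite one; lra.
- by under eq_avg do rewrite Q_sym; rewrite one; lra.
by rewrite (avg_coord2 (fun w x => (Q w x)%:R)) // lerDl addr_ge0.
Qed.

Lemma avg_pinned_conflict a x b y : a != b -> ~~ Q x y ->
  avg (fun phi => [&& phi a == x, phi b == y & conflict phi]%:R) <=
  conflict_bound x y / n ^+ 2.
Proof.
move=> ab Qxy.
under eq_avg do rewrite andbA -mulnb natrM.
rewrite avg_pin2 // ler_pM2r ?invr_gt0 ?exprn_gt0 //.
pose G s t phi : R := (Q (upd (upd phi b y) a x s) (upd (upd phi b y) a x t))%:R.
apply: le_trans (_ : avg (fun phi => \sum_s \sum_(t | s != t) G s t phi) <= _).
  apply: ler_avg => phi; case: (boolP (conflict _)) => [|_]; last first.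
    by rewrite sumr_ge0 // => s _; rewrite sumr_ge0.
  move=> /existsP[s /existsP[t /andP[st Qst]]].
  rewrite (bigD1 s) //= (bigD1 t) //= /G Qst -addrA lerDl addr_ge0 ?sumr_ge0 // => i _.
  by rewrite sumr_ge0.
rewrite avg_sum; under eq_bigr do rewrite avg_sum.
apply: le_trans (_ : \sum_(s : V) \sum_(t : V)
   ((\sum_w qdeg w) / n ^+ 2 + (qdeg x + qdeg y) / n) <= _); last first.
  by rewrite !sumr_const -mulrnA -[_ *+ (_ * _)]mulr_natl natrM -expr2.
apply: ler_sum => s _; rewrite big_mkcond; apply: ler_sum => t _; case: ifP => st.
  exact: avg_conflict_pair.
by rewrite addr_ge0 ?divr_ge0 ?addr_ge0 ?exprn_ge0 ?ler0n ?sumr_ge0.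
Qed.

Lemma card_pinned_conflict a x b y : a != b -> ~~ Q x y ->
  #|[set phi : {ffun V -> W} | [&& phi a == x, phi b == y & conflict phi]]|%:R <=
  conflict_bound x y * n ^+ #|V| / n ^+ 2.
Proof.
move=> ab Qxy; rewrite mulrAC -ler_pdivrMr ?exprn_gt0 //.
by rewrite -avg_card avg_pinned_conflict.
Qed.

Lemma avg_family (A : V -> {set W}) :
  avg (fun phi => [forall s, phi s \in A s]%:R) = \prod_s (#|A s|%:R / n).
Proof.
rewrite avg_card prodf_div prodr_const; congr (_ / _); rewrite -natr_prod.
transitivity (#|family (fun s => mem (A s))|%:R : R).
  by congr (_%:R); apply: eq_card => phi; rewrite inE.
by rewrite card_family foldrE big_image.
Qed.

(** The two singletons give the factor [n ^- 2]. Only [#|V| - 2] factors [tau] are needed; as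
    [tau <= 1], the exponent [#|V|] is a valid weakening free of subtraction. *)
Lemma card_family_conflict_free u v x y (A : V -> {set W}) (tau : R) :
  u != v -> ~~ Q x y -> A u = [set x] -> A v = [set y] -> 0 <= tau <= 1 ->
  (forall s, s != u -> s != v -> tau * n <= #|A s|%:R) ->
  (tau ^+ #|V| - conflict_bound x y) * n ^+ #|V| / n ^+ 2 <=
  #|[set phi : {ffun V -> W} | [forall s, phi s \in A s] && ~~ conflict phi]|%:R.
Proof.
move=> uv Qxy Au Av /andP[tau0 tau1] Aw.
rewrite mulrAC -ler_pdivlMr ?exprn_gt0 // -avg_card.
apply: le_trans (_ : avg (fun phi => [forall s, phi s \in A s]%:R + - 1 *
   [&& phi u == x, phi v == y & conflict phi]%:R) <= _); last first.
  apply: ler_avg => phi; case: (boolP [forall s, _]) => [/forallP Aphi|_] /=.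
    have := Aphi u; have := Aphi v; rewrite Au Av !inE => -> -> /=.
    by case: conflict => /=; lra.
  by case: (_ && _) => /=; lra.
rewrite avgD avgZ avg_family mulrBl mulN1r lerB ?avg_pinned_conflict //.
rewrite (bigD1 u) //= (bigD1 v) 1?eq_sym //= Au Av !cards1 !div1r mulrA -invfM -expr2.
rewrite [leRHS]mulrC ler_pM2r ?invr_gt0 ?exprn_gt0 //.
apply: le_trans (_ : \prod_(s | (s != u) && (s != v)) tau <= _).
  by rewrite prodr_const ler_wiXn2l ?max_card.
apply: ler_prod => s /andP[su sv]; rewrite tau0 ler_pdivlMr //.
by apply: Aw.
Qed.

End Conflict.
End PinnedMaps.

(** * Copies *)

Section Graphs.
Implicit Types (V W : finType).

Lemma edgeP W (G : sgraph W) e : e \in edges G ->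
  exists x y, [/\ x != y, e = [set x; y] & adj G x y].
Proof.
move=> eG; have /eqP/cards2P[x [y [xy eE]]] := card_edge eG.
by exists x, y; split; rewrite // /adj -eE.
Qed.

Lemma adj_sym W (G : sgraph W) : symmetric (adj G).
Proof. by move=> x y; rewrite /adj setUC. Qed.

Lemma adj_neq W (G : sgraph W) x y : adj G x y -> x != y.
Proof. by apply: contraTneq => ->; rewrite adjxx. Qed.

Lemma imset_pair (T T' : finType) (f : T -> T') x y : f @: [set x; y] = [set f x; f y].
Proof. by rewrite imsetU1 imset_set1. Qed.

Lemma eq_set2 (T : finType) (x y x' y' : T) : [set x; y] = [set x'; y'] ->
  x = x' /\ y = y' \/ x = y' /\ y = x'.
Proof.
move=> E; have := set21 x y; have := set22 x y; rewrite E !inE.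
have := set21 x' y'; have := set22 x' y'; rewrite -E !inE.
by move=> /pred2P[] ? /pred2P[] ? /pred2P[] ? /pred2P[] ?; subst; auto.
Qed.

Section Copies.
Variables (V W : finType) (F : sgraph V).
Implicit Types (H : sgraph W) (f : {ffun V -> W}) (C : {set W} * {set {set W}}).

Definition inj_hom H f :=
  injectiveb f && [forall a, forall b, adj F a b ==> adj H (f a) (f b)].

Definition copy_of f : {set W} * {set {set W}} :=
  (f @: [set: V], [set f @: (e : {set V}) | e in edges F]).

Lemma inj_homP H f : reflect (injective f /\ forall a b, adj F a b -> adj H (f a) (f b))
  (inj_hom H f).
Proof.
apply: (iffP andP) => [[/injectiveP ? h]|[? h]]; split=> //.
- by move=> a b; move/forallP/(_ a)/forallP/(_ b)/implyP: h.
- exact/injectiveP.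
- by apply/forallP => a; apply/forallP => b; apply/implyP/h.
Qed.

Lemma copy_of_sub H f :
  ((copy_of f).2 \subset edges H) = [forall a, forall b, adj F a b ==> adj H (f a) (f b)].
Proof.
apply/subsetP/forallP => [h a|h _ /imsetP[e /edgeP[a [b [_ -> ab]]] ->]].
  apply/forallP => b; apply/implyP => ab; rewrite /adj -imset_pair.
  by apply: h; apply: imset_f.
by rewrite imset_pair; have /forallP/(_ b)/implyP := h a; apply.
Qed.

Lemma is_copyP H C :
  reflect (exists2 f, inj_hom H f & C = copy_of f) (is_copy F H C.1 C.2).
Proof.
apply: (iffP andP) => [[CH /existsP[f /and3P[f_inj /eqP C1 /eqP C2]]]|[f /andP[f_inj fH] ->]].
  have CE : C = copy_of f by case: C C1 C2 {CH} => ? ? /= -> ->.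
  by exists f => //; rewrite /inj_hom f_inj -copy_of_sub -CE.
split; first by rewrite copy_of_sub.
by apply/existsP; exists f; rewrite f_inj !eqxx.
Qed.

(** Maps giving the same copy have the same image. The crude [f ^ f], in place of the number of
    automorphisms, is enough where constants are free; the exact comparison is made between
    copies. *)
Lemma card_inj_hom_le H :
  #|[set f | inj_hom H f]| <= copies F H * #|V| ^ #|V|.
Proof.
rewrite -sum1_card (partition_big_imset copy_of) /=.
have sub : [set copy_of f | f in [set f | inj_hom H f]] \subset
    [set C | is_copy F H C.1 C.2].
  apply/subsetP => C /imsetP[f]; rewrite inE => fH CE.
  by rewrite inE; apply/is_copyP; exists f.
apply: leq_trans (leq_mul (subset_leq_card sub) (leqnn _)).
rewrite -sum_nat_const; apply: leq_sum => C /imsetP[f0 _ ->].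
apply: leq_trans (_ : #|ffun_on (mem (copy_of f0).1)| <= _).
  rewrite sum1_card; apply: subset_leq_card; apply/subsetP => f.
  rewrite unfold_in => /andP[_ /eqP <-]; apply/ffun_onP => a.
  exact: imset_f.
rewrite card_ffun_on; case: (posnP #|V|) => [->|V0]; first by rewrite !expn0.
by rewrite leq_exp2r // -[leqRHS]cardsT leq_imset_card.
Qed.

End Copies.

Lemma copies_transport (V W W' : finType) (F : sgraph V) (h : W' -> W)
    (G' : sgraph W') (G : sgraph W) : injective h ->
  (forall x y, adj G' x y -> adj G (h x) (h y)) -> copies F G' <= copies F G.
Proof.
move=> h_inj hG; rewrite /copies.
pose k (C : {set W'} * {set {set W'}}) : {set W} * {set {set W}} :=
  (h @: C.1, [set h @: (e : {set W'}) | e in C.2]).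
have k_inj : injective k.
  move=> [C1 C2] [D1 D2] [/imset_inj-/(_ h_inj) -> /imset_inj E].
  by congr pair; apply: E; apply: imset_inj.
rewrite -(card_imset _ k_inj); apply: subset_leq_card; apply/subsetP => _ /imsetP[C + ->].
rewrite !inE => /is_copyP[f /inj_homP[f_inj fG] ->]; apply/is_copyP.
exists [ffun a => h (f a)].
  apply/inj_homP; split=> [a b|a b ab]; rewrite !ffunE; last exact/hG/fG.
  by move/h_inj/f_inj.
rewrite /k /copy_of /=; congr pair.
  by rewrite -imset_comp; apply: eq_imset => a; rewrite ffunE.
rewrite -imset_comp; apply: eq_imset => e /=.
by rewrite -imset_comp; apply: eq_imset => a; rewrite ffunE.
Qed.

Definition mono (W : finType) (C : eqType) (p : W -> C) (e : {set W}) :=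
  [forall x in e, forall y in e, p x == p y].

Lemma mono2 (W : finType) (C : eqType) (p : W -> C) x y :
  mono p [set x; y] = (p x == p y).
Proof.
apply/forall_inP/eqP => [/(_ x (set21 x y))/forall_inP/(_ y (set22 x y))/eqP //|pxy z].
move=> /set2P[]-> ; apply/forall_inP => w /set2P[]->; rewrite ?pxy //.
Qed.

Lemma multipartite_plus_simple (W : finType) (C : eqType) (p : W -> C) (b : {set W}) :
  [forall e in [set e : {set W} | (#|e| == 2) && ((e == b) || ~~ mono p e)], #|e| == 2].
Proof. by apply/forall_inP => e; rewrite inE => /andP[]. Qed.

(** For balanced [p] and an edge [b] inside a part, this is the Turan graph plus an edge, built on
    [W] itself so that it can be compared with [H]. *)
Definition multipartite_plus (W : finType) (C : eqType) (p : W -> C) (b : {set W}) :=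
  SGraph (multipartite_plus_simple p b).

Lemma adj_multipartite_plus (W : finType) (C : eqType) (p : W -> C) (b : {set W}) x y :
  adj (multipartite_plus p b) x y = (x != y) && (([set x; y] == b) || (p x != p y)).
Proof.
rewrite /adj inE mono2 cards2; congr (_ && _).
by case: (x != y).
Qed.

Section OneEdge.
Variables (V W : finType) (F : sgraph V) (r : nat).
Hypothesis F_chi : ~~ is_colorable F r.
Implicit Types (p : W -> 'I_r).

Lemma mono_edge p (f : V -> W) : exists a b, adj F a b /\ p (f a) = p (f b).
Proof.
move: F_chi; rewrite negb_exists => /forallP/(_ [ffun a => p (f a)]).
rewrite negb_forall => /existsP[a]; rewrite negb_forall => /existsP[b].
by rewrite negb_imply negbK !ffunE => /andP[ab /eqP pab]; exists a, b.
Qed.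

(** Some edge of [F] has both ends in one part, because [p \o f] cannot colour [F] properly; inside
    the parts the host has only the edge [xy]. *)
Lemma inj_hom_through_edge p x y f :
  inj_hom F (multipartite_plus p [set x; y]) f ->
  exists a b, [/\ adj F a b, f a = x & f b = y].
Proof.
move=> /inj_homP[_ fG]; have [a [b [ab pab]]] := mono_edge p f.
have := fG a b ab; rewrite adj_multipartite_plus pab eqxx orbF => /andP[_ /eqP/eq_set2].
by case=> -[fa fb]; [exists a, b | exists b, a]; rewrite // adj_sym.
Qed.

Variables (H : sgraph W) (p p' : W -> 'I_r) (x y : W).

Definition mono_edges := [set e in edges H | mono p e].

(* A copy that uses [xy] in the complete multipartite graph of [p'] plus [xy]  *)
(* and none of whose pairs is an obstruction lies in [H], with [xy] as its     *)
(* only edge inside a part of [p].                                            *)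
Definition obstruction : rel W := fun v w =>
  [|| p v != p' v, p w != p' w | (p v != p w) && ~~ adj H v w].

Lemma copies_one_edge : adj H x y -> p x = p y -> p' x = p x -> p' y = p y ->
  copies F (multipartite_plus p' [set x; y]) <=
    #|[set C | is_copy F H C.1 C.2 & C.2 :&: mono_edges == [set [set x; y]]]| +
    \sum_(ab : V * V | ab.1 != ab.2)
      #|[set f : {ffun V -> W} | [&& f ab.1 == x, f ab.2 == y & conflict obstruction f]]|.
Proof.
move=> Hxy pxy p'x p'y; rewrite /copies.
set G := multipartite_plus _ _; set good := [set C | _ & _].
(* Lost copies are bounded by the number of maps producing them: multiplicities are harmless in an
   error term. *)
pose bad := \bigcup_(ab : V * V | ab.1 != ab.2)
  [set f : {ffun V -> W} | [&& f ab.1 == x, f ab.2 == y & conflict obstruction f]].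
apply: leq_trans (_ : #|good :|: copy_of F @: bad| <= _); last first.
  apply: leq_trans (leq_card_setU _ _) _; rewrite leq_add2l.
  apply: leq_trans (leq_imset_card _ _) _.
  rewrite /bad; elim/big_ind2: _ => [|A m B k Am Bk|//]; first by rewrite cards0.
  exact: leq_trans (leq_card_setU _ _) (leq_add Am Bk).
apply: subset_leq_card; apply/subsetP => C; rewrite !inE => /is_copyP[f fG ->].
have [a [b [ab fa fb]]] := inj_hom_through_edge fG.
move/inj_homP: fG => [f_inj fG].
have [fbad|fgood] := boolP (conflict obstruction f).
  apply/orP; right; apply/imset_f/bigcupP; exists (a, b); first exact: (adj_neq ab).
  by rewrite inE /= fa fb !eqxx.
apply/orP; left.
have key s t : adj F s t -> adj H (f s) (f t) /\
    (p (f s) = p (f t) -> [set f s; f t] = [set x; y]).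
  move=> st; have := fG s t st; rewrite adj_multipartite_plus.
  case/andP=> _ /orP[/eqP fst|p'st]; first by rewrite fst /adj fst.
  move: fgood; rewrite /conflict negb_exists => /forallP/(_ s).
  rewrite negb_exists => /forallP/(_ t); rewrite (adj_neq st) /= /obstruction.
  rewrite !negb_or !negbK => /and3P[/eqP ps /eqP pt]; rewrite ps pt p'st /= negbK.
  by move=> ->; split=> // E; rewrite E eqxx in p'st.
apply/andP; split.
  apply/is_copyP; exists f => //; apply/inj_homP; split=> // s t st.
  by have [] := key s t st.
apply/eqP/setP => e; rewrite !inE; apply/andP/eqP => [[/imsetP[e' e'F ->]]|->].
  have [s [t [_ -> st]]] := edgeP e'F.
  by rewrite imset_pair mono2 => /andP[_ /eqP/(proj2 (key s t st))].
rewrite mono2 pxy eqxx andbT; split; last exact: Hxy.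
by rewrite -fa -fb -imset_pair; apply: imset_f.
Qed.

End OneEdge.

Lemma sum_isolated_copies (V W : finType) (F : sgraph V) (H : sgraph W) (B : {set {set W}}) :
  \sum_(b in B) #|[set C : {set W} * {set {set W}} |
     is_copy F H C.1 C.2 & C.2 :&: B == [set b]]| <= copies F H.
Proof.
rewrite /copies -sum1_card.
under eq_bigr do rewrite -sum1_card.
rewrite (exchange_big_dep [in [set C | is_copy F H C.1 C.2]]) /=; last first.
  by move=> b C _; rewrite !inE => /andP[].
apply: leq_sum => C CH; rewrite sum1_card.
apply/card_le1_eqP => b b'; rewrite -!topredE /= !inE.
by move=> /and3P[_ _ /eqP ->] /and3P[_ _ /eqP/set1_inj].
Qed.

End Graphs.

(** * Balanced partitions and the Turan graph *)

Section BalancedPartitions.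
Variables (r : nat) (W : finType).
Hypothesis r_gt0 : 0 < r.
Implicit Types (p q : W -> 'I_r) (i j : 'I_r) (v w x y : W).

Definition part p i := [set v | p v == i].
Definition balanced p := forall i j, #|part p i| <= #|part p j|.+1.
Definition part_squares p := \sum_i #|part p i| ^ 2.
(* Ordered pairs, here and for all edge counts below: each edge counts twice.  *)
Definition cross_pairs p := \sum_v \sum_w (p v != p w : nat).

Lemma sum_part p : \sum_i #|part p i| = #|W|.
Proof.
rewrite -sum1_card (partition_big p xpredT) //=.
by apply: eq_bigr => i _; rewrite -sum1_card; apply: eq_bigl => v; rewrite inE.
Qed.

Lemma cross_pairs_squares p : cross_pairs p + part_squares p = #|W| ^ 2.
Proof.
have -> : part_squares p = \sum_v #|part p (p v)|.
  rewrite [RHS](partition_big p xpredT) //=; apply: eq_bigr => i _.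
  rewrite (eq_bigr (fun _ => #|part p i|)) => [|v /eqP -> //].
  rewrite sum_nat_const -mulnn; congr (_ * _).
  by apply: eq_card => v; rewrite !inE.
rewrite -big_split /= -mulnn -sum_nat_const; apply: eq_bigr => v _.
have -> : #|part p (p v)| = \sum_w (p v == p w).
  rewrite -sum1_card big_mkcond; apply: eq_bigr => w _.
  by rewrite inE eq_sym; case: eqP.
by rewrite -big_split -sum1_card; apply: eq_bigr => w _; case: eqP.
Qed.

(** Moving a vertex from a part of size [A + 1] to one of size [B < A] lowers the sum of squares by
    [2 (A - B)]: at least two units per moved vertex, the price used in [balance]. *)
Lemma part_squares_move p v j : #|part p j|.+1 < #|part p (p v)| ->
  part_squares (fun w => if w == v then j else p w) + 2 <= part_squares p.
Proof.
set i := p v; set q := fun w => _ => ij.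
have ne_ij : j != i by apply: contraTneq ij => ->; rewrite -leqNgt.
have qi : part p i = v |: part q i.
  by apply/setP => w; rewrite !inE /q; have [->|] := eqVneq w v; rewrite ?eqxx.
have qj : part q j = v |: part p j.
  by apply/setP => w; rewrite !inE /q; have [->|] := eqVneq w v; rewrite ?eqxx.
have vq : v \notin part q i by rewrite inE /q eqxx.
have vp : v \notin part p j by rewrite inE eq_sym.
have qk k : k != i -> k != j -> #|part q k| = #|part p k|.
  move=> ki kj; apply: eq_card => w; rewrite !inE /q; have [->|//] := eqVneq w v.
  by rewrite -/i ![_ == k]eq_sym (negPf kj) (negPf ki).
rewrite /part_squares (bigD1 i) // (bigD1 j) // [leqRHS](bigD1 i) // [X in _ <= _ + X](bigD1 j) //=.
rewrite (eq_bigr (fun k => #|part p k| ^ 2)) => [|k /andP[ki kj]]; last by rewrite qk.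
move: ij; rewrite qi qj !cardsU1 vq vp /=.
set A := #|part q i|; set B := #|part p j|; set X := \sum_(_ | _) _ => ij.
have : A.+1 ^ 2 = A ^ 2 + 2 * A + 1 by lia.
have : B.+1 ^ 2 = B ^ 2 + 2 * B + 1 by lia.
rewrite !add1n; move: (A ^ 2) (B ^ 2) (A.+1 ^ 2) (B.+1 ^ 2) X ij; clear; lia.
Qed.

(* The two vertices kept in place are the ends of an edge inside a part.      *)
Lemma balance p x y : 3 * r <= #|W| ->
  exists q, [/\ balanced q, q x = p x, q y = p y &
    2 * #|[set v | p v != q v]| + part_squares q <= part_squares p].
Proof.
move=> rW.
pose P (q : {ffun W -> 'I_r}) := [&& q x == p x, q y == p y &
  2 * #|[set v | p v != q v]| + part_squares q <= part_squares p].
have ex : exists q : {ffun W -> 'I_r}, P q.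
  exists [ffun v => p v]; rewrite /P !ffunE !eqxx /=.
  have -> : [set v | p v != [ffun v => p v] v] = set0.
    by apply/setP => v; rewrite !inE ffunE eqxx.
  rewrite cards0 muln0 add0n leq_eqVlt; apply/orP; left; apply/eqP.
  by apply: eq_bigr => i _; congr (_ ^ 2); apply: eq_card => v; rewrite !inE ffunE.
have [q0 Pq0] := ex; case: (arg_minnP (fun q : {ffun W -> 'I_r} => part_squares q) Pq0).
move=> q /and3P[/eqP qx /eqP qy qp] qmin; exists q; split=> //.
case: (arg_maxnP (fun i => #|part q i|) (erefl true : xpredT (Ordinal r_gt0))) => i _ imax.
case: (arg_minnP (fun i => #|part q i|) (erefl true : xpredT (Ordinal r_gt0))) => j _ jmin.
move=> i' j'; rewrite leqNgt; apply/negP => ij'.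
have ij : #|part q j|.+1 < #|part q i|.
  by apply: leq_trans (imax i' isT); apply: leq_ltn_trans ij'; rewrite ltnS jmin.
(* As [3 * r <= #|W|], a largest part has at least three vertices, so one of them is neither [x] nor
   [y] and may be moved. *)
have i3 : 2 < #|part q i|.
  rewrite -(leq_pmul2l r_gt0) mulnC (leq_trans rW) // -(sum_part q).
  rewrite -[X in _ <= X * _]card_ord -sum_nat_const.
  by apply: leq_sum => k _; apply: imax.
have [v] : exists v, v \in part q i :\ x :\ y.
  apply/card_gt0P; move: i3; rewrite (cardsD1 x) (cardsD1 y (part q i :\ x)).
  by case: (_ \in _) => /=; case: (_ \in _) => /=; lia.
rewrite !inE => /and3P[vy vx /eqP vi].
pose q1 := [ffun w => if w == v then j else q w].
have sq1 : part_squares q1 + 2 <= part_squares q.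
  rewrite -vi in ij; apply: leq_trans (part_squares_move ij); rewrite leq_add2r.
  apply: leq_sum => k _; rewrite leq_exp2r //; apply: subset_leq_card.
  by apply/subsetP => w; rewrite !inE ffunE.
suff /qmin le_q1 : P q1.
  by have := leq_trans sq1 le_q1; rewrite -[leqRHS]addn0 leq_add2l.
rewrite /P !ffunE ![_ == v]eq_sym (negPf vx) (negPf vy) qx qy !eqxx /=.
have : #|[set w | p w != q1 w]| <= #|v |: [set w | p w != q w]|.
  apply: subset_leq_card; apply/subsetP => w; rewrite !inE ffunE.
  by have [->|] := eqVneq w v.
rewrite cardsU1 => /leq_trans/(_ (leq_add (leq_b1 _) (leqnn _))) dq1.
move: dq1 sq1 qp; move: (part_squares q1) (part_squares q) (part_squares p) => a1 a2 a3.
move: #|_| #|_| => b1 b2; clear; lia.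
Qed.

Lemma balanced_squares p : balanced p ->
  r * part_squares p <= #|W| * (#|W| + r).
Proof.
move=> bal; rewrite /part_squares big_distrr /= -{1}(sum_part p) big_distrl /=.
apply: leq_sum => i _; rewrite -mulnn mulnCA leq_mul2l; apply/orP; right.
have -> : r * #|part p i| = \sum_(j < r) #|part p i| by rewrite sum_nat_const card_ord.
have -> : #|W| + r = \sum_(j < r) (#|part p j| + 1).
  by rewrite big_split /= sum_part sum1_card card_ord.
by apply: leq_sum => j _; rewrite addn1 bal.
Qed.

(** Send the vertex of rank [idx] in part number [k] to [idx * r + k], numbering the larger parts
    first: only residues below [#|L|] occur [m.+1] times, which keeps all values below
    [#|W| = m * r + #|L|]. *)
Lemma balanced_turan p : balanced p ->
  exists2 g : W -> 'I_#|W|, injective g &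
    forall v w, (g v %% r == g w %% r) = (p v == p w).
Proof.
move=> bal; pose a i := #|part p i|.
case: (arg_minnP a (erefl true : xpredT (Ordinal r_gt0))) => i0 _ imin.
set m := a i0 in imin.
pose L := [set i | a i == m.+1].
have aE i : a i = m + (i \in L).
  rewrite inE; have := imin i isT; have := bal i i0; rewrite -/(a i) -/(a i0) -/m.
  by case: eqP => /=; lia.
have W_card : #|W| = m * r + #|L|.
  rewrite -(sum_part p) (eq_bigr _ (fun i _ => aE i)) big_split /= sum_nat_const card_ord.
  by rewrite mulnC -sum1_card [in RHS]big_mkcond; congr (_ + _);
    apply: eq_bigr => i _; case: (i \in L).
pose s := enum L ++ enum (~: L); pose k i := index i s.
have sP i : i \in s by rewrite mem_cat !mem_enum in_setC orbN.
have kr i : k i < r.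
  apply: leq_trans (_ : size s <= _); first by rewrite index_mem.
  by rewrite size_cat -!cardE cardsC card_ord.
have kL i : i \in L -> k i < #|L|.
  by move=> iL; rewrite /k index_cat mem_enum iL cardE index_mem mem_enum.
have k_inj : injective k.
  by move=> i j /(congr1 (nth i0 s)); rewrite !nth_index.
pose idx v := index v (enum (part p (p v))).
have idxP v : idx v < a (p v) by rewrite /a cardE index_mem mem_enum inE.
have gP v : idx v * r + k (p v) < #|W|.
  have := idxP v; rewrite aE W_card; have := kr (p v); have := @kL (p v).
  case: (_ \in L) => [/(_ isT) kl _|_ kr' ]; rewrite ?addn1 ?addn0 => lt_idx.
    apply: leq_ltn_trans (_ : m * r + k (p v) < _); last by rewrite ltn_add2l.
    by rewrite leq_add2r leq_mul2r -ltnS lt_idx orbT.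
  apply: leq_trans (_ : (idx v).+1 * r <= _); first by rewrite mulSn addnC ltn_add2r.
  by apply: leq_trans (leq_addr _ _); rewrite leq_mul2r lt_idx orbT.
pose g v := Ordinal (gP v).
have gr v w : (g v %% r == g w %% r) = (p v == p w).
  by rewrite /= !modnMDl !modn_small ?kr // (inj_eq k_inj).
exists g => // v w gvw.
have pvw : p v = p w by apply/eqP; rewrite -gr gvw.
move/(congr1 val): gvw => /= /(congr1 (divn^~ r)).
rewrite !divnMDl // !divn_small ?kr // !addn0 /idx pvw => /(congr1 (nth v (enum (part p (p w))))).
by rewrite !nth_index // mem_enum inE ?pvw.
Qed.

End BalancedPartitions.

Section OrderedPairs.
Variable (W : finType).

Lemma handshake (E : {set {set W}}) (g : {set W} -> nat) :
  (forall e, e \in E -> #|e| = 2) ->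
  \sum_v \sum_w ([set v; w] \in E) * g [set v; w] = 2 * \sum_(e in E) g e.
Proof.
move=> E2; pose h v w := \sum_(e in E) ([set v; w] == e) * g e.
rewrite (eq_bigr (fun v => \sum_w h v w)) => [|v _]; last first.
  apply: eq_bigr => w _; rewrite /h; have [vwE|vwE] := boolP (_ \in E).
    rewrite (bigD1 [set v; w]) //= eqxx big1 ?addn0 // => e /andP[_ /negPf].
    by rewrite eq_sym => ->.
  by rewrite big1 // => e eE; case: eqP vwE => // -> /negP.
rewrite pair_bigA exchange_big big_distrr /=; apply: eq_bigr => e eE.
rewrite -big_distrl /=; congr (_ * _).
have /eqP/cards2P[x [y [xy ->]]] := E2 e eE.
rewrite (bigD1 (x, y)) //= eqxx (bigD1 (y, x)) /=; last first.
  by rewrite xpair_eqE negb_and eq_sym xy.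
rewrite setUC eqxx big1 // => -[v w] /= /andP[vw vw'].
by case: eqP => // /eq_set2[[? ?]|[? ?]]; move: vw vw'; subst; rewrite eqxx.
Qed.

Lemma card_adj (G : sgraph W) : \sum_v \sum_w adj G v w = 2 * #|edges G|.
Proof.
rewrite -sum1_card -handshake => [|e]; last exact: card_edge.
by apply: eq_bigr => v _; apply: eq_bigr => w _; rewrite muln1.
Qed.

End OrderedPairs.

Section TuranComparison.
Variables (r : nat) (W : finType).
Hypothesis r_gt0 : 0 < r.

Lemma balanced_turan_size (p : W -> 'I_r) : balanced p ->
  cross_pairs p = 2 * turan_size r #|W|.
Proof.
move=> /(balanced_turan r_gt0)[g g_inj gE].
have g_bij : bijective g by apply: inj_card_bij; rewrite ?card_ord.
rewrite -card_turan // -card_adj /cross_pairs.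
rewrite [RHS](reindex g) /=; last exact: onW_bij.
apply: eq_bigr => v _; rewrite [RHS](reindex g) /=; last exact: onW_bij.
by apply: eq_bigr => w _; rewrite adj_turan gE.
Qed.

Lemma cross_pairs_le (p : W -> 'I_r) x y : 3 * r <= #|W| ->
  exists q, [/\ balanced q, q x = p x, q y = p y &
    2 * #|[set v | p v != q v]| + cross_pairs p <= 2 * turan_size r #|W|].
Proof.
move=> /(balance r_gt0 p x y)[q [bal qx qy le_q]]; exists q; split=> //.
rewrite -(balanced_turan_size bal) -(leq_add2r (part_squares p)) -addnA.
rewrite cross_pairs_squares -(cross_pairs_squares q) addnC -addnA leq_add2l.
by rewrite addnC.
Qed.

Lemma turan_size_ge : 3 * r <= #|W| ->
  r * #|W| ^ 2 <= r * (2 * turan_size r #|W|) + #|W| * (#|W| + r).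
Proof.
move=> rW; have [x _] : exists x : W, x \in W.
  by apply/card_gt0P; rewrite (leq_trans _ rW) ?muln_gt0.
have [q [bal _ _ _]] := balance r_gt0 (fun=> Ordinal r_gt0) x x rW.
rewrite -(cross_pairs_squares q) (balanced_turan_size bal) mulnDr leq_add2l.
exact: balanced_squares.
Qed.

Lemma min_copies_le (V : finType) (F : sgraph V) (p : W -> 'I_r) x y :
  r < #|W| -> balanced p -> x != y -> p x = p y ->
  min_copies r #|W| F <= copies F (multipartite_plus p [set x; y]).
Proof.
move=> rW /(balanced_turan r_gt0)[g g_inj gE] xy pxy.
have [g' gK g'K] : bijective g by apply: inj_card_bij; rewrite ?card_ord.
have simple : [forall e in [set g x; g y] |: edges (turan r #|W|), #|e| == 2].
  apply/forall_inP => e /setU1P[->|/card_edge -> //].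
  by rewrite cards2 (inj_eq g_inj) xy.
have [_ _] := @min_copiesP r #|W| V F (introT andP (conj r_gt0 rW)).
move=> /(_ (SGraph simple)) le_min; apply: leq_trans (le_min _) _.
  apply/existsP; exists [set g x; g y]; rewrite eqxx andbT.
  by have := adj_turan r (g x) (g y); rewrite /adj => ->; rewrite gE pxy eqxx.
apply: (@copies_transport V W _ F g'); first exact: can_inj g'K.
move=> a b; rewrite /adj in_setU1 => ab.
have ne_ab : a != b.
  case/orP: ab => [/eqP E|/(@adj_neq _ (turan r #|W|)) //].
  have : #|[set a; b]| = 2 by rewrite E cards2 (inj_eq g_inj) xy.
  by rewrite cards2; case: (a != b).
rewrite -/(adj _ _ _) adj_multipartite_plus (can_eq g'K) ne_ab /=.
case/orP: ab => [/eqP E|]; last first.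
  rewrite -/(adj (turan r #|W|) a b) adj_turan => ab; apply/orP; right.
  by rewrite -gE !g'K.
apply/orP; left; apply/eqP.
by rewrite -imset_pair E imset_pair !gK.
Qed.

End TuranComparison.

(** * Colour-critical graphs *)

Section CriticalGraphs.
Variables (r : nat) (V : finType) (F : sgraph V).
Hypotheses (r_gt0 : 0 < r) (F_crit : critical r F).

Lemma colorableP k (G : sgraph V) :
  reflect (exists c : V -> 'I_k, forall a b, adj G a b -> c a != c b) (is_colorable G k).
Proof.
apply: (iffP existsP) => [[c h]|[c h]].
  by exists c => a b ab; have /forallP/(_ b)/implyP := forallP h a; apply.
exists [ffun a => c a]; apply/forallP => a; apply/forallP => b; apply/implyP => ab.
by rewrite !ffunE h.
Qed.

Lemma chromatic_colorable (G : sgraph V) : is_colorable G (chromatic_number G).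
Proof. by rewrite /chromatic_number; case: ex_minnP. Qed.

Lemma critical_not_colorable : ~~ is_colorable F r.
Proof.
have [+ _] := F_crit; apply: contra_eqN => F_col; rewrite neq_ltn.
by rewrite /chromatic_number; case: ex_minnP => m _ /(_ r F_col) mr; rewrite ltnS mr.
Qed.

Definition critical_coloring (u v : V) (c : V -> 'I_r) :=
  [/\ adj F u v, c u = c v &
    forall a b, adj F a b -> c a = c b -> [set a; b] = [set u; v]].

(** The colour [i] of the critical edge is free, by permuting colours, because the edge of [H] to
    which it is mapped may lie in any part. *)
Lemma critical_coloringP :
  exists u v, forall i, exists2 c, critical_coloring u v c & c u = i.
Proof.
have [_ [e eF chi_e]] := F_crit.
have [u [v [_ eE uv]]] := edgeP eF.
have := chromatic_colorable (del_edge F e); rewrite chi_e => /colorableP[c cP].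
have cF a b : adj F a b -> c a = c b -> [set a; b] = [set u; v].
  move=> ab cab; apply/eqP; apply: contraTT (introT eqP cab) => abuv.
  by apply: cP; rewrite /adj !inE eE abuv.
have cuv : c u = c v.
  apply/eqP; apply: contraT => cuv; case/negP: critical_not_colorable.
  apply/colorableP; exists c => a b ab; apply/eqP => cab.
  have := cF a b ab cab => /eq_set2[[aE bE]|[aE bE]]; move: cab cuv; rewrite aE bE.
    by move=> ->; rewrite eqxx.
  by move=> ->; rewrite eqxx.
exists u, v => i; exists (fun a => tperm (c u) i (c a)); last by rewrite tpermL.
split=> //; first by rewrite cuv.
by move=> a b ab /perm_inj; apply: cF.
Qed.

(** A missed colour would leave an r-colouring. One vertex of each colour then forms the clique
    whose blow-up contains [F]. *)
Lemma critical_surjective_coloring : exists2 c : V -> 'I_r.+1,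
  (forall a b, adj F a b -> c a != c b) & forall i, exists a, c a = i.
Proof.
have [chiF _] := F_crit; have := chromatic_colorable F; rewrite chiF.
move=> /colorableP[c cP]; exists c => // i.
have [/existsP[a /eqP]|] := boolP [exists a, c a == i]; first by exists a.
rewrite negb_exists => /forallP no_a; case/negP: critical_not_colorable.
have lift_c a : exists j, c a = lift i j.
  by have /unlift_some[j -> _] : i != c a; [rewrite eq_sym | exists j].
apply/colorableP; exists (fun a => odflt (Ordinal r_gt0) (unlift i (c a))) => a b ab.
have [j cj] := lift_c a; have [k ck] := lift_c b.
have := cP a b ab; rewrite cj ck !liftK /=; apply: contra => /eqP -> //.
Qed.

End CriticalGraphs.

(** * Embeddings that send the critical edge to an edge inside a part *)

Section Host.
Local Open Scope ring_scope.
Variables (R : realFieldType) (r : nat) (V : finType) (F : sgraph V).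
Variables (W : finType) (H : sgraph W) (p : W -> 'I_r).
Hypothesis W_gt0 : (0 < #|W|)%N.
Implicit Types (x y w z : W) (a b s u v : V) (c : V -> 'I_r) (phi : {ffun V -> W}).

Local Notation n := (#|W|%:R : R).
Local Notation f := #|V|.

Let n_gt0 : 0 < n. Proof. by rewrite ltr0n. Qed.

Definition missing : rel W := fun w z => (p w != p z) && ~~ adj H w z.
Definition mono_deg w : R := \sum_z (adj H w z && (p w == p z))%:R.
Definition missing_deg w : R := \sum_z (missing w z)%:R.

Lemma missing_deg_ge0 w : 0 <= missing_deg w.
Proof. by rewrite sumr_ge0. Qed.

Lemma mono_deg_ge0 w : 0 <= mono_deg w.
Proof. by rewrite sumr_ge0. Qed.

Lemma missing_sym : symmetric missing.
Proof. by move=> w z; rewrite /missing adj_sym eq_sym. Qed.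

Lemma inj_hom_of_coloring u v c phi : critical_coloring F u v c ->
  (forall a b, a != b -> ~~ ((phi a == phi b) || missing (phi a) (phi b))) ->
  (forall a, p (phi a) = c a) -> adj H (phi u) (phi v) -> inj_hom F H phi.
Proof.
move=> [_ _ cF] free pc uv; apply/inj_homP; split=> [a b /eqP E|a b ab].
  by apply: contraTeq E => /free; rewrite negb_or => /andP[].
have := free a b (adj_neq ab); rewrite negb_or => /andP[_].
rewrite negb_and !negbK => /orP[/eqP|//]; rewrite !pc => /(cF a b ab)/eq_set2.
by case=> -[-> ->]; rewrite // adj_sym.
Qed.

Lemma conflict_bound_le (Q : rel W) x y (E dx dy : R) :
  \sum_w qdeg R Q w <= E -> qdeg R Q x <= dx -> qdeg R Q y <= dy ->
  conflict_bound R V Q x y <= f%:R ^+ 2 * (E / n ^+ 2 + (dx + dy) / n).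
Proof.
move=> hE hx hy; rewrite ler_wpM2l ?exprn_ge0 // lerD //.
  by rewrite ler_pM2r ?invr_gt0 ?exprn_gt0.
by rewrite ler_pM2r ?invr_gt0 ?lerD.
Qed.

Definition homs_through u v x y := [set phi | [&& inj_hom F H phi, phi u == x & phi v == y]].

(** [Q] has to catch coincidences and missing edges only among [x], [y] and the sets [A i]. This
    freedom allows a smaller [Q] when the [A i] lie in the neighbourhood of [x]. *)
Lemma family_count u v c x y (tau E dx dy : R) (Q : rel W) (A : 'I_r -> {set W}) :
  critical_coloring F u v c -> c u = p x -> adj H x y -> p x = p y ->
  0 <= tau <= 1 -> (forall i, tau * n <= #|A i|%:R) -> (forall i, A i \subset part p i) ->
  symmetric Q -> ~~ Q x y ->
  (forall i w, w \in A i -> (x == w) || missing x w -> Q x w) ->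
  (forall i w, w \in A i -> (y == w) || missing y w -> Q y w) ->
  (forall i j w z, w \in A i -> z \in A j -> (w == z) || missing w z -> Q w z) ->
  \sum_w qdeg R Q w <= E -> qdeg R Q x <= dx -> qdeg R Q y <= dy ->
  (tau ^+ f - f%:R ^+ 2 * (E / n ^+ 2 + (dx + dy) / n)) * n ^+ f / n ^+ 2 <=
  #|homs_through u v x y|%:R.
Proof.
move=> ccF cu xy pxy tau01 tau_A A_part Q_sym Qxy Qx Qy Qw hE hx hy.
have [uv_adj cuv _] := ccF; have uv := adj_neq uv_adj.
pose A' s := if s == u then [set x] else if s == v then [set y] else A (c s).
have A'u : A' u = [set x] by rewrite /A' eqxx.
have A'v : A' v = [set y] by rewrite /A' eq_sym (negPf uv) eqxx.
have A'P s w : w \in A' s -> [\/ s = u /\ w = x, s = v /\ w = y | w \in A (c s)].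
  rewrite /A'; have [->|_] := eqVneq s u; first by rewrite inE => /eqP; constructor 1.
  have [->|_] := eqVneq s v; first by rewrite inE => /eqP; constructor 2.
  by constructor 3.
have A'tau s : s != u -> s != v -> tau * n <= #|A' s|%:R.
  by move=> su sv; rewrite /A' (negPf su) (negPf sv).
have := card_family_conflict_free W_gt0 Q_sym uv Qxy A'u A'v tau01 A'tau.
move=> h; apply: le_trans (le_trans _ h) _.
  rewrite ler_pM2r ?invr_gt0 ?exprn_gt0 // ler_pM2r ?exprn_gt0 // lerB //.
  exact: conflict_bound_le.
rewrite ler_nat; apply: subset_leq_card; apply/subsetP => phi.
rewrite !inE => /andP[/forallP phiA free].
have phi_u : phi u = x by apply/set1P; rewrite -A'u.
have phi_v : phi v = y by apply/set1P; rewrite -A'v.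
rewrite phi_u phi_v !eqxx !andbT; apply: (inj_hom_of_coloring ccF).
- move=> a b ab; have : ~~ Q (phi a) (phi b).
    apply: contra free => Qab; apply/existsP; exists a; apply/existsP; exists b.
    by rewrite ab.
  apply: contra => conf.
  have conf' : (phi b == phi a) || missing (phi b) (phi a) by rewrite missing_sym eq_sym.
  have [[aE pa]|[aE pa]|pa] := A'P a _ (phiA a); have [[bE pb]|[bE pb]|pb] := A'P b _ (phiA b).
  + by rewrite aE bE eqxx in ab.
  + by move: conf; rewrite pa pb /missing pxy eqxx orbF => /eqP E'; rewrite E' adjxx in xy.
  + by rewrite pa in conf *; apply: Qx pb conf.
  + by move: conf; rewrite pa pb /missing pxy eqxx orbF => /eqP E'; rewrite E' adjxx in xy.
  + by rewrite aE bE eqxx in ab.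
  + by rewrite pa in conf *; apply: Qy pb conf.
  + by rewrite Q_sym; rewrite pb in conf' *; apply: Qx pa conf'.
  + by rewrite Q_sym; rewrite pb in conf' *; apply: Qy pa conf'.
  + exact: Qw pa pb conf.
- move=> a; have [[-> ->]|[-> ->]|] := A'P a _ (phiA a); first by rewrite cu.
    by rewrite -cuv cu pxy.
  by move=> /(subsetP (A_part _)); rewrite inE => /eqP.
- by rewrite phi_u phi_v.
Qed.

Lemma sum_eq_or_missing w : \sum_z ((w == z) || missing w z)%:R <= 1 + missing_deg w.
Proof.
rewrite (bigD1 w) //= eqxx lerD // /missing_deg [leRHS](bigD1 w) //=.
rewrite ler_wpDl // ler_sum // => z zw; rewrite ler_nat eq_sym.
by rewrite (negPf zw).
Qed.

Lemma edge_count u v c x y (tau : R) :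
  critical_coloring F u v c -> c u = p x -> adj H x y -> p x = p y ->
  0 <= tau <= 1 -> (forall i, tau * n <= #|part p i|%:R) ->
  (tau ^+ f - f%:R ^+ 2 * ((n + \sum_w missing_deg w) / n ^+ 2 +
     (1 + missing_deg x + (1 + missing_deg y)) / n)) * n ^+ f / n ^+ 2 <=
  #|homs_through u v x y|%:R.
Proof.
move=> ccF cu xy pxy tau01 tau_part.
apply: (family_count (Q := fun w z => (w == z) || missing w z) (A := part p)
  ccF cu xy pxy tau01 tau_part) => //.
- by move=> w z; rewrite missing_sym eq_sym.
- by rewrite negb_or /missing pxy eqxx (adj_neq xy).
- apply: le_trans (ler_sum _ (fun w _ => sum_eq_or_missing w)) _.
  by rewrite big_split sumr_const.
- exact: sum_eq_or_missing.
- exact: sum_eq_or_missing.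
Qed.

(* All other vertices of the copy are placed in the neighbourhood of [x], so   *)
(* missing edges at [x] do no harm.                                           *)
Lemma star_edge_count u v c x y (tau : R) :
  critical_coloring F u v c -> c u = p x -> adj H x y -> p x = p y ->
  0 <= tau <= 1 -> (forall i, tau * n <= #|[set w in part p i | adj H x w]|%:R) ->
  (tau ^+ f - f%:R ^+ 2 * ((n + \sum_w missing_deg w) / n ^+ 2 +
     (0 + (1 + missing_deg y)) / n)) * n ^+ f / n ^+ 2 <=
  #|homs_through u v x y|%:R.
Proof.
move=> ccF cu xy pxy tau01 tau_part.
pose Q w z := [&& adj H x w, adj H x z & (w == z) || missing w z].
have qdegQ w : qdeg R Q w <= 1 + missing_deg w.
  apply: le_trans (sum_eq_or_missing w); apply: ler_sum => z _.
  by rewrite ler_nat /Q; case: adj; case: adj; case: orb.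
apply: (family_count (Q := Q) (A := fun i => [set w in part p i | adj H x w])
  ccF cu xy pxy tau01 tau_part) => //.
- by move=> i; apply/subsetP => w; rewrite inE => /andP[].
- by move=> w z; rewrite /Q missing_sym eq_sym andbCA.
- by rewrite /Q adjxx.
- move=> i w; rewrite !inE => /andP[_ xw] /orP[/eqP E|]; first by rewrite E adjxx in xw.
  by rewrite /missing xw andbF.
- by move=> i w; rewrite !inE /Q xy => /andP[_ ->] ->.
- by move=> i j w z; rewrite !inE /Q => /andP[_ ->] /andP[_ ->] ->.
- apply: le_trans (ler_sum _ (fun w _ => qdegQ w)) _.
  by rewrite big_split sumr_const.
- by rewrite /qdeg big1 // => z _; rewrite /Q adjxx.
Qed.

Lemma sum_homs_through u v :
  (\sum_x \sum_y #|homs_through u v x y|)%N = #|[set phi | inj_hom F H phi]|.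
Proof.
rewrite pair_bigA -sum1_card (partition_big (fun phi => (phi u, phi v)) xpredT) //=.
apply: eq_bigr => -[x y] _; rewrite -sum1_card; apply: eq_bigl => phi.
by rewrite !inE xpair_eqE.
Qed.

End Host.

(** * The order of magnitude of c(n,F) *)

Section MinCopies.
Local Open Scope ring_scope.
Variables (R : realFieldType) (r : nat) (V : finType) (F : sgraph V).
Hypotheses (r_gt0 : (0 < r)%N) (F_crit : critical r F).

Local Notation f := #|V|.
Let tau : R := (2 * r%:R)^-1.

Let rR_gt0 : 0 < r%:R :> R. Proof. by rewrite ltr0n. Qed.

Lemma tau01 : 0 <= tau <= 1.
Proof.
have : 1 <= r%:R :> R by rewrite ler1n.
by rewrite /tau invr_ge0 => r1; apply/andP; split; [lra | rewrite invf_le1; lra].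
Qed.

Lemma min_copies_lower n : (r < n)%N -> (2 * r <= n)%N ->
  f%:R ^+ 2 * (3 / n%:R) <= tau ^+ f / 2 ->
  (tau ^+ f / 2) * n%:R ^+ f / n%:R ^+ 2 <= (min_copies r n F)%:R * (f ^ f)%:R.
Proof.
move=> rn rn2 n_large.
have n_gt0 : 0 < n%:R :> R by rewrite ltr0n; apply: leq_ltn_trans rn.
have [G [/existsP[e /andP[eT /eqP GE]] ->] _] := @min_copiesP r n V F (introT andP (conj r_gt0 rn)).
have [x [y [xy eE Gxy]]] : exists x y, [/\ x != y, e = [set x; y] & adj G x y].
  by apply: edgeP; rewrite GE setU11.
pose p (x : 'I_n) := Ordinal (ltn_pmod x r_gt0).
have adjG v w : p v != p w -> adj G v w.
  rewrite -val_eqE /= -adj_turan => vw.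
  by rewrite /adj GE setU1r.
have pxy : p x = p y.
  apply/val_inj => /=; apply/eqP; rewrite -[_ == _]negbK -adj_turan.
  by rewrite /adj -eE.
have mdeg w : missing_deg R G p w = 0.
  rewrite /missing_deg big1 // => z _; rewrite /missing.
  by case: (boolP (p w != p z)) => //= /adjG ->.
have [u [v /(_ (p x))[c ccF cu]]] := critical_coloringP F_crit.
have W_gt0 : (0 < #|'I_n|)%N by rewrite card_ord; apply: leq_ltn_trans rn.
have parts i : tau * #|'I_n|%:R <= #|part p i|%:R.
  have -> : #|part p i| = ((n + (r - i) - 1) %/ r)%N.
    by rewrite -card_turan_part //; apply: eq_card => w; rewrite !inE -val_eqE.
  rewrite card_ord /tau mulrC ler_pdivrMr ?mulr_gt0 // mulrC -!natrM ler_nat.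
  have := ltn_ceil (n + (r - i) - 1) r_gt0; have := ltn_ord i.
  move: ((_ %/ r)%N) => k; move: r_gt0 rn2; clear; nia.
have := edge_count W_gt0 ccF cu Gxy pxy tau01 parts.
rewrite !mdeg big1 // !addr0 card_ord => count.
apply: le_trans (le_trans _ count) _.
  rewrite ler_pM2r ?invr_gt0 ?exprn_gt0 // ler_pM2r ?exprn_gt0 //.
  (* No edge between parts is missing, so only coincidences of values are lost: [1 / n] for free
     pairs and [2 / n] for those involving [x] or [y]. *)
  rewrite [X in X + (1 + 1) / _](_ : _ = 1 / n%:R); last by field; rewrite gt_eqF.
  rewrite -mulrDl (_ : 1 + (1 + 1) = 3); last by ring.
  lra.
rewrite -natrM ler_nat; apply: leq_trans (card_inj_hom_le F G).
apply: subset_leq_card; apply/subsetP => phi; rewrite !inE.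
by case/and3P.
Qed.

Variables (W : finType).
Hypothesis W_gt0 : (0 < #|W|)%N.
Let n : R := #|W|%:R.

(** Every copy uses [xy]: at most [f ^ 2] ordered pairs of vertices of [F] can be sent there, and
    the other values are free. *)
Lemma copies_plus_upper (p : W -> 'I_r) x y :
  (copies F (multipartite_plus p [set x; y]))%:R <= f%:R ^+ 2 * n ^+ f / n ^+ 2.
Proof.
have n_gt0 : 0 < n by rewrite ltr0n.
pose X (ab : V * V) := [set phi : {ffun V -> W} | (phi ab.1 == x) && (phi ab.2 == y)].
have sub : [set C | is_copy F (multipartite_plus p [set x; y]) C.1 C.2] \subset
   copy_of F @: \bigcup_(ab : V * V | ab.1 != ab.2) X ab.
  apply/subsetP => C; rewrite inE => /is_copyP[phi phiG ->].
  have [a [b [ab fa fb]]] := inj_hom_through_edge (critical_not_colorable F_crit) phiG.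
  apply/imset_f/bigcupP; exists (a, b); first exact: (adj_neq ab).
  by rewrite inE /= fa fb !eqxx.
apply: le_trans (_ : (\sum_(ab : V * V | ab.1 != ab.2) #|X ab|)%:R <= _).
  rewrite ler_nat; apply: leq_trans (subset_leq_card sub) _.
  apply: leq_trans (leq_imset_card _ _) _.
  elim/big_ind2: _ => [|A m B k Am Bk|//]; first by rewrite cards0.
  exact: leq_trans (leq_card_setU _ _) (leq_add Am Bk).
have XE ab : ab.1 != ab.2 -> #|X ab|%:R = n ^+ f / n ^+ 2.
  move=> ab12; have := avg_pin2 (R := R) W_gt0 x y (fun=> 1) ab12.
  rewrite avg_cst // mul1r.
  rewrite (eq_avg (h := fun phi => ((phi ab.1 == x) && (phi ab.2 == y))%:R)); last first.
    by move=> phi; rewrite mulr1.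
  rewrite avg_card -/(X ab) => /(canRL (divfK _)) ->; last by rewrite expf_neq0 ?gt_eqF.
  by rewrite mulrC.
rewrite natr_sum (eq_bigr (fun=> n ^+ f / n ^+ 2)) => [|ab /XE -> //].
rewrite sumr_const -[_ *+ _]mulr_natl -mulrA ler_wpM2r ?divr_ge0 ?exprn_ge0 ?ler0n //.
by rewrite expr2 -natrM ler_nat -card_prod max_card.
Qed.

End MinCopies.

(** * Counting copies near the Turan graph *)

Section FewMonochromaticEdges.
Local Open Scope ring_scope.
Variables (R : realFieldType) (r : nat) (V : finType) (F : sgraph V).
Hypotheses (r_gt0 : (0 < r)%N) (F_crit : critical r F).
Variables (W : finType) (H : sgraph W) (q : nat).
Hypotheses (W_gt0 : (0 < #|W|)%N) (rW : (r < #|W|)%N) (rW3 : (3 * r <= #|W|)%N).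
Hypothesis H_edges : #|edges H| = (turan_size r #|W| + q)%N.

Local Notation n := (#|W|%:R : R).
Local Notation f := #|V|.
Local Notation K := (n ^+ f / n ^+ 2).

Let n_gt0 : 0 < n. Proof. by rewrite ltr0n. Qed.
Let n_ge1 : 1 <= n. Proof. by rewrite ler1n. Qed.
Let K_ge0 : 0 <= K. Proof. by rewrite divr_ge0 ?exprn_ge0 ?ler0n. Qed.

Section Partition.
Variable p : W -> 'I_r.
Local Notation oB := (\sum_w mono_deg R H p w).
Local Notation oM := (\sum_w missing_deg R H p w).
(** Twice the deficit D, as [cross_pairs] counts ordered pairs; likewise [oB] and [oM] are twice |B|
    and |M|. *)
Let D2 : R := 2 * (turan_size r #|W|)%:R - (cross_pairs p)%:R.

Lemma mono_missing_balance : oB = 2 * q%:R + oM + D2.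
Proof.
have : \sum_w \sum_z (adj H w z)%:R + oM = oB + (cross_pairs p)%:R.
  rewrite /cross_pairs natr_sum -!big_split; apply: eq_bigr => w _ /=.
  rewrite natr_sum -!big_split; apply: eq_bigr => z _ /=; rewrite /missing.
  by case: adj; case: (p w == p z); rewrite /= ?addr0 ?add0r.
have -> : \sum_w \sum_z (adj H w z)%:R = (2 * (turan_size r #|W| + q))%:R :> R.
  by rewrite -H_edges -card_adj natr_sum; apply: eq_bigr => w _; rewrite natr_sum.
by rewrite natrM natrD /D2; lra.
Qed.

Lemma deficit_ge0 : 0 <= D2.
Proof.
have /card_gt0P[x _] := W_gt0.
have [p1 [_ _ _ le_T]] := cross_pairs_le r_gt0 p x x rW3.
rewrite subr_ge0 -natrM ler_nat; apply: leq_trans le_T; exact: leq_addl.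
Qed.

Definition isolated_copies (b : {set W}) :=
  #|[set C | is_copy F H C.1 C.2 & C.2 :&: mono_edges H p == [set b]]|.

(** Rebalancing moves at most [D2 / 2] vertices. A moved vertex may obstruct all its [n] pairs, but
    [x] and [y] stay in place, so their obstruction degrees remain small. The factor [f ^ 4] counts
    ordered pairs sent to [(x, y)] times conflicting pairs. *)
Lemma min_copies_le_isolated x y : adj H x y -> p x = p y ->
  (min_copies r #|W| F)%:R <= (isolated_copies [set x; y])%:R +
    f%:R ^+ 4 * K * (2 * D2 / n + oM / n ^+ 2 +
      (missing_deg R H p x + missing_deg R H p y) / n).
Proof.
move=> xy pxy; have [p' [bal p'x p'y le_T]] := cross_pairs_le r_gt0 p x y rW3.
have xNy := adj_neq xy.
have p'xy : p' x = p' y by rewrite p'x p'y.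
set Z := [set v | p v != p' v] in le_T.
have zD2 : 2 * #|Z|%:R <= D2.
  by rewrite /D2 lerBrDr -!natrM -natrD ler_nat.
pose Q := obstruction H p p'.
have Q_sym : symmetric Q.
  by move=> v w; rewrite /Q /obstruction adj_sym [p v == p w]eq_sym orbCA.
have Qxy : ~~ Q x y by rewrite /Q /obstruction p'x p'y pxy !eqxx.
have sumZ : \sum_w (p w != p' w)%:R = #|Z|%:R :> R.
  rewrite -natr_sum; congr (_%:R); rewrite -sum1_card [RHS]big_mkcond.
  by apply: eq_bigr => w _; rewrite inE; case: eqP.
have qdegQ w : qdeg R Q w <= n * (p w != p' w)%:R + (#|Z|%:R + missing_deg R H p w).
  apply: le_trans (_ : \sum_z ((p w != p' w)%:R + ((p z != p' z)%:R +
     (missing H p w z)%:R)) <= _).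
    apply: ler_sum => z _; rewrite -!natrD ler_nat /Q /obstruction -/(missing H p w z).
    by case: eqP; case: eqP; case: missing.
  by rewrite !big_split /= sumZ sumr_const -[_ *+ #|_|]mulr_natl.
have bound : conflict_bound R V Q x y <= f%:R ^+ 2 * ((D2 * n + oM) / n ^+ 2 +
    (D2 / 2 + missing_deg R H p x + (D2 / 2 + missing_deg R H p y)) / n).
  apply: conflict_bound_le => //.
  - apply: le_trans (ler_sum _ (fun w _ => qdegQ w)) _.
    rewrite !big_split /= -mulr_sumr sumZ sumr_const -[#|Z|%:R *+ _]mulr_natl.
    by rewrite addrA lerD2r -mulrDr mulrC ler_pM2r //; lra.
  - by apply: le_trans (qdegQ x) _; rewrite p'x eqxx mulr0 add0r lerD2r; lra.
  - by apply: le_trans (qdegQ y) _; rewrite p'y eqxx mulr0 add0r lerD2r; lra.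
have := min_copies_le r_gt0 F rW bal xNy p'xy.
move=> /leq_trans/(_ (copies_one_edge (critical_not_colorable F_crit) xy pxy p'x p'y)).
rewrite -(ler_nat R) natrD => /le_trans; apply; rewrite lerD2l natr_sum.
apply: le_trans (_ : \sum_(ab : V * V | ab.1 != ab.2) conflict_bound R V Q x y * K <= _).
  apply: ler_sum => ab ab12; rewrite mulrA.
  exact: card_pinned_conflict.
apply: le_trans (_ : f%:R ^+ 2 * (conflict_bound R V Q x y * K) <= _).
  rewrite sumr_const -[(_ * K) *+ _]mulr_natl ler_wpM2r //.
    rewrite mulr_ge0 // mulr_ge0 ?exprn_ge0 // addr_ge0 ?divr_ge0 ?addr_ge0 ?exprn_ge0 ?ler0n //;
    by rewrite ?sumr_ge0 // => *; rewrite sumr_ge0.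
  by rewrite expr2 -natrM ler_nat -card_prod max_card.
rewrite [leRHS](_ : _ = f%:R ^+ 2 * (f%:R ^+ 2 * ((D2 * n + oM) / n ^+ 2 +
    (D2 / 2 + missing_deg R H p x + (D2 / 2 + missing_deg R H p y)) / n) * K)); last first.
  by field; rewrite gt_eqF.
by rewrite ler_wpM2l ?exprn_ge0 ?ler0n // ler_wpM2r.
Qed.

Lemma sum_isolated : \sum_x \sum_y (adj H x y && (p x == p y))%:R *
  (isolated_copies [set x; y])%:R <= 2 * (copies F H)%:R :> R.
Proof.
have B2 e : e \in mono_edges H p -> #|e| = 2 by rewrite inE => /andP[/card_edge].
have := leq_mul (leqnn 2) (sum_isolated_copies F H (mono_edges H p)).
rewrite -handshake // -(ler_nat R) natrM; apply: le_trans; rewrite natr_sum.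
apply: ler_sum => x _; rewrite natr_sum; apply: ler_sum => y _.
by rewrite natrM inE mono2.
Qed.

(* Here [oB = 2 q + oM + D2]: each missing edge and each unit of imbalance is  *)
(* compensated by an extra monochromatic edge, which yields about             *)
(* [min_copies] new copies, while it spoils only O(eps n^(f-2)) of them.      *)
Lemma few_mono_edges (eps : R) : oB <= 2 * eps * n ->
  6 * eps * f%:R ^+ 4 * K <= (min_copies r #|W| F)%:R ->
  (q * min_copies r #|W| F <= copies F H)%N.
Proof.
set c := min_copies _ _ _ => B_small eps_small.
have D0 := deficit_ge0; have M0 : 0 <= oM by rewrite sumr_ge0 // => w _; exact: missing_deg_ge0.
have B0 : 0 <= oB by rewrite sumr_ge0 // => w _; exact: mono_deg_ge0.
have BM : \sum_w mono_deg R H p w * missing_deg R H p w <= oB * oM.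
  rewrite mulr_sumr; apply: ler_sum => w _; rewrite ler_wpM2r ?missing_deg_ge0 //.
  by rewrite (bigD1 w) //= lerDl sumr_ge0 // => z _; exact: mono_deg_ge0.
set k := f%:R ^+ 4 * K; have k0 : 0 <= k by rewrite mulr_ge0 ?exprn_ge0 ?ler0n.
have main : oB * c%:R <= 2 * (copies F H)%:R +
    k * (oB * (2 * D2 / n + oM / n ^+ 2) +
         2 * ((\sum_w mono_deg R H p w * missing_deg R H p w) / n)).
  apply: le_trans (_ : \sum_x \sum_y ((adj H x y && (p x == p y))%:R *
     (isolated_copies [set x; y])%:R + k * ((adj H x y && (p x == p y))%:R *
       (2 * D2 / n + oM / n ^+ 2 + (missing_deg R H p x + missing_deg R H p y) / n))) <= _).
    rewrite mulr_suml; apply: ler_sum => x _; rewrite mulr_suml; apply: ler_sum => y _.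
    case: (boolP (_ && _)) => [/andP[xy /eqP pxy]|_]; last by rewrite !mul0r mulr0 addr0.
    by rewrite !mul1r; apply: min_copies_le_isolated.
  rewrite (eq_bigr (fun x => \sum_y (adj H x y && (p x == p y))%:R *
     (isolated_copies [set x; y])%:R + k * \sum_y (adj H x y && (p x == p y))%:R *
       (2 * D2 / n + oM / n ^+ 2 + (missing_deg R H p x + missing_deg R H p y) / n)))
    => [|x _]; last by rewrite big_split /= mulr_sumr.
  rewrite big_split /= -mulr_sumr lerD ?sum_isolated // ler_wpM2l //.
  rewrite (eq_bigr (fun x => mono_deg R H p x * (2 * D2 / n + oM / n ^+ 2) +
     (mono_deg R H p x * missing_deg R H p x / n +
      \sum_y (adj H x y && (p x == p y))%:R * missing_deg R H p y / n))) => [|x _]; last first.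
    rewrite /mono_deg !mulr_suml -!big_split; apply: eq_bigr => y _ /=.
    by ring.
  rewrite !big_split /= -mulr_suml lerD2l -mulr_suml.
  rewrite [X in _ + X](_ : _ = (\sum_w mono_deg R H p w * missing_deg R H p w) / n); last first.
    rewrite exchange_big mulr_suml; apply: eq_bigr => y _.
    rewrite /mono_deg !mulr_suml; apply: eq_bigr => x _.
    by rewrite adj_sym eq_sym.
  by rewrite -mulr2n mulr_natl.
(* The 3 is one [oM] from [oM / n ^+ 2 <= oM / n] and two from the missing degrees at both ends, via
   [BM]. With [oB <= 2 * eps * n] this yields the constant 6 of the hypothesis. *)
have {main BM} : oB * c%:R <= 2 * (copies F H)%:R + k * (oB / n) * (2 * D2 + 3 * oM).
  apply: le_trans main _; rewrite lerD2l -[k * (oB / n) * _]mulrA ler_wpM2l //.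
  apply: le_trans (_ : oB * (2 * D2 / n + oM / n) + 2 * ((oB * oM) / n) <= _); last first.
    by rewrite le_eqVlt; apply/orP; left; apply/eqP; field; rewrite gt_eqF.
  apply: lerD; last by rewrite ler_pM2l // ler_pM2r // invr_gt0.
  rewrite ler_wpM2l // lerD2l ler_wpM2l // lef_pV2 ?posrE ?exprn_gt0 //.
  by rewrite expr2 ler_peMl // ltW.
have : k * (oB / n) * (2 * D2 + 3 * oM) <= c%:R * (D2 + oM).
  apply: le_trans (_ : k * (2 * eps) * (2 * D2 + 3 * oM) <= _).
    rewrite ler_wpM2r ?addr_ge0 ?mulr_ge0 // ler_wpM2l // ler_pdivrMr //.
  apply: le_trans (_ : k * (2 * eps) * (3 * (D2 + oM)) <= _).
    have eps0 : 0 <= 2 * eps by have := le_trans B0 B_small; rewrite pmulr_lge0.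
    apply: ler_wpM2l; first exact: mulr_ge0.
    by lra.
  rewrite [_ * (3 * _)]mulrA; apply: ler_wpM2r; first exact: addr_ge0.
  apply: le_trans eps_small; rewrite le_eqVlt; apply/orP; left; apply/eqP.
  by rewrite /k; ring.
by rewrite -(ler_nat R) natrM mono_missing_balance; lra.
Qed.

End Partition.
End FewMonochromaticEdges.

Section ManyMonochromaticEdges.
Local Open Scope ring_scope.
Variables (R : realFieldType) (r : nat) (V : finType) (F : sgraph V).
Hypothesis F_crit : critical r F.
Variables (W : finType) (H : sgraph W) (p : W -> 'I_r).
Hypothesis W_gt0 : (0 < #|W|)%N.

Local Notation n := (#|W|%:R : R).
Local Notation f := #|V|.
Local Notation K := (n ^+ f / n ^+ 2).
Local Notation oB := (\sum_w mono_deg R H p w).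
Local Notation oM := (\sum_w missing_deg R H p w).
Local Notation inj_homs := (#|[set phi : {ffun V -> W} | inj_hom F H phi]|%:R : R).

Let n_gt0 : 0 < n. Proof. by rewrite ltr0n. Qed.
Let K_ge0 : 0 <= K. Proof. by rewrite divr_ge0 ?exprn_ge0 ?ler0n. Qed.

(** The cut condition gives [x] at least [eta * n] neighbours in every part. Each neighbour [y] in
    its own part contributes about [eta ^+ f * K], whence the exponent [f.+1]. Missing edges at
    single [y] are not controlled, so these losses are averaged over [y]. *)
Lemma high_mono_degree (eta mu : R) x :
  (forall i, mono_deg R H p x <= #|[set w in part p i | adj H x w]|%:R) ->
  0 < eta <= 1 -> eta * n <= mono_deg R H p x -> oM <= mu * n ^+ 2 ->
  4 * (f%:R ^+ 2 * (1 / n + mu)) <= eta ^+ f.+1 ->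
  eta ^+ f.+1 / 2 * n * K <= inj_homs.
Proof.
move=> max_cut /andP[eta0 eta1] eta_x M_small small.
have [u [v /(_ (p x))[c ccF cu]]] := critical_coloringP F_crit.
have mu0 : 0 <= mu.
  have : 0 <= oM by rewrite sumr_ge0 // => w _; exact: missing_deg_ge0.
  by move=> /le_trans/(_ M_small); rewrite pmulr_lge0 // exprn_gt0.
set s := 1 / n + mu in small; have s0 : 0 <= s by rewrite addr_ge0 ?divr_ge0 // ltW.
set S := f%:R ^+ 2 * s in small; have S0 : 0 <= S by rewrite mulr_ge0 ?exprn_ge0.
have nM : n + oM <= s * n ^+ 2.
  by rewrite mulrDl expr2 mulrA divfK ?gt_eqF // mul1r -expr2 lerD2l.
rewrite -(sum_homs_through F H u v) natr_sum.
apply: le_trans (_ : (\sum_y #|homs_through F H u v x y|)%:R <= _); last first.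
  by rewrite [leRHS](bigD1 x) //= lerDl sumr_ge0.
(* For other [y] the left side is nonpositive; the losses may thus be summed over all [y], giving
   [n + oM]. *)
have cnt y : ((adj H x y && (p x == p y))%:R * (eta ^+ f - S) -
    f%:R ^+ 2 * ((1 + missing_deg R H p y) / n)) * K <= #|homs_through F H u v x y|%:R.
  have m0 := missing_deg_ge0 R H p y.
  have [/andP[xy /eqP pxy]|_] := boolP (_ && _); last first.
    apply: le_trans (ler0n _ _); rewrite mul0r sub0r mulNr oppr_le0.
    apply: mulr_ge0 => //; apply: mulr_ge0; first by rewrite exprn_ge0.
    by rewrite divr_ge0 ?addr_ge0.
  apply: le_trans (star_edge_count W_gt0 ccF cu xy pxy _ _); first last.
  - by move=> i; apply: le_trans eta_x (max_cut i).
  - by rewrite ltW.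
  rewrite mul1r -[leRHS]mulrA ler_wpM2r // add0r mulrDr opprD addrA lerD2r lerD2l lerN2.
  by rewrite ler_wpM2l ?exprn_ge0 ?ler0n // ler_pdivrMr ?exprn_gt0.
rewrite natr_sum; apply: le_trans (ler_sum _ (fun y _ => cnt y)).
rewrite -mulr_suml ler_wpM2r // sumrB -mulr_suml -/(mono_deg R H p x) -mulr_sumr.
rewrite -mulr_suml big_split sumr_const /=.
have etaS : S <= eta ^+ f.
  have e0 : 0 <= eta ^+ f by rewrite exprn_ge0 // ltW.
  apply: le_trans (_ : eta ^+ f.+1 <= _); first by lra.
  by rewrite exprS ler_piMl.
have h1 : eta * n * (eta ^+ f - S) <= mono_deg R H p x * (eta ^+ f - S).
  by rewrite ler_wpM2r // subr_ge0.
have h2 : f%:R ^+ 2 * ((n + oM) / n) <= S * n.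
  rewrite /S -[leRHS]mulrA ler_wpM2l ?exprn_ge0 ?ler0n // ler_pdivrMr //.
  by rewrite -mulrA -expr2.
apply: le_trans (_ : eta * n * (eta ^+ f - S) - S * n <= _); last by rewrite lerB.
have -> : eta * n * (eta ^+ f - S) - S * n = (eta ^+ f.+1 - eta * S - S) * n.
  by rewrite exprS; ring.
rewrite ler_pM2r //; have : eta * S <= S by rewrite ler_piMl.
lra.
Qed.

(* At a vertex with more than [kappa n] missing edges, these outnumber the     *)
(* monochromatic ones by a factor 4; as [oM <= oB], at least half of the      *)
(* monochromatic edges avoid such vertices.                                   *)
Lemma low_mono_degrees (tau eps eta kappa mu : R) :
  0 <= tau <= 1 -> (forall i, tau * n <= #|part p i|%:R) ->
  (forall x, mono_deg R H p x <= eta * n) -> 0 < kappa -> 0 <= eta -> 4 * eta <= kappa ->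
  oM <= oB -> oM <= mu * n ^+ 2 -> 2 * eps * n <= oB ->
  2 * (f%:R ^+ 2 * (3 / n + mu + 2 * kappa)) <= tau ^+ f ->
  eps * (tau ^+ f / 2) * n * K <= inj_homs.
Proof.
move=> tau01 tau_part eta_deg kappa0 eta0 eta_kappa MB M_small B_large small.
have [u [v uvP]] := critical_coloringP F_crit.
pose big w := kappa * n < missing_deg R H p w.
pose B x y := adj H x y && (p x == p y).
have t0 : 0 <= tau ^+ f / 2 by case/andP: tau01 => t0 _; rewrite divr_ge0 ?exprn_ge0.
have cnt x y : (B x y && ~~ big x && ~~ big y)%:R * (tau ^+ f / 2 * K) <=
    #|homs_through F H u v x y|%:R.
  rewrite /B /big -!leNgt; case: (boolP (_ && _)) => [|_]; last by rewrite mul0r.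
  move=> /andP[/andP[/andP[xy /eqP pxy]] x_small y_small].
  have [c ccF cu] := uvP (p x).
  apply: le_trans (edge_count W_gt0 ccF cu xy pxy tau01 tau_part).
  rewrite mul1r -[leRHS]mulrA ler_wpM2r //.
  suff : (n + oM) / n ^+ 2 + (1 + missing_deg R H p x + (1 + missing_deg R H p y)) / n <=
     3 / n + mu + 2 * kappa.
    by move=> /(ler_wpM2l (exprn_ge0 2 (ler0n R f))); lra.
  have e1 : oM / n ^+ 2 <= mu by rewrite ler_pdivrMr ?exprn_gt0.
  have e2 : missing_deg R H p x / n <= kappa by rewrite ler_pdivrMr.
  have e3 : missing_deg R H p y / n <= kappa by rewrite ler_pdivrMr.
  rewrite !mulrDl (_ : n / n ^+ 2 = 1 / n); last by field; rewrite gt_eqF.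
  by lra.
have big_le x : mono_deg R H p x * (big x)%:R <= (1 / 4) * missing_deg R H p x.
  have m0 := missing_deg_ge0 R H p x.
  rewrite /big; case: ltP => [bx|_] /=; last by rewrite mulr0; apply: mulr_ge0; rewrite ?divr_ge0.
  rewrite mulr1; apply: le_trans (eta_deg x) _.
  have := ler_wpM2r (ltW n_gt0) eta_kappa; lra.
have B_sym x y : B x y = B y x by rewrite /B adj_sym eq_sym.
have big_sum : \sum_x \sum_y (B x y)%:R * (big x)%:R <= oB / 4.
  apply: le_trans (_ : (1 / 4) * oM <= _); last by lra.
  by rewrite mulr_sumr; apply: ler_sum => x _; rewrite -mulr_suml; apply: big_le.
have big_sum' : \sum_x \sum_y (B x y)%:R * (big y)%:R <= oB / 4.
  rewrite exchange_big /=; apply: le_trans big_sum; apply: ler_sum => x _.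
  by apply: ler_sum => y _; rewrite B_sym.
have good : oB / 2 <= \sum_x \sum_y (B x y && ~~ big x && ~~ big y)%:R.
  have : oB <= \sum_x \sum_y ((B x y && ~~ big x && ~~ big y)%:R +
      ((B x y)%:R * (big x)%:R + (B x y)%:R * (big y)%:R)).
    apply: ler_sum => x _; apply: ler_sum => y _; rewrite -/(B x y) -!natrM -!natrD ler_nat.
    by case: (B x y); case: (big x); case: (big y).
  rewrite [X in _ <= X -> _](eq_bigr (fun x => \sum_y (B x y && ~~ big x && ~~ big y)%:R +
    (\sum_y (B x y)%:R * (big x)%:R + \sum_y (B x y)%:R * (big y)%:R))) => [|x _];
    last by rewrite big_split /= big_split.
  by rewrite [X in _ <= X -> _]big_split /= [X in _ <= _ + X -> _]big_split /=; lra.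
rewrite -(sum_homs_through F H u v) natr_sum.
apply: le_trans (_ : \sum_x \sum_y (B x y && ~~ big x && ~~ big y)%:R * (tau ^+ f / 2 * K) <= _).
  rewrite (eq_bigr (fun x => (\sum_y (B x y && ~~ big x && ~~ big y)%:R) * (tau ^+ f / 2 * K)))
    => [|x _]; last by rewrite mulr_suml.
  rewrite -mulr_suml; apply: le_trans (_ : (eps * n) * (tau ^+ f / 2 * K) <= _).
    by rewrite le_eqVlt; apply/orP; left; apply/eqP; ring.
  apply: ler_wpM2r; first exact: mulr_ge0.
  by apply: le_trans good; lra.
apply: ler_sum => x _; rewrite natr_sum; apply: ler_sum => y _; exact: cnt.
Qed.

End ManyMonochromaticEdges.

(** * Maximum cuts *)

Section MaxCut.
Variables (r : nat) (W : finType) (H : sgraph W).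

Definition mono_count (p : W -> 'I_r) := \sum_v \sum_w (adj H v w && (p v == p w)).

Lemma mono_count_split (p : W -> 'I_r) x : mono_count p =
  2 * (\sum_w (adj H x w && (p x == p w))) +
  \sum_(v | v != x) \sum_(w | w != x) (adj H v w && (p v == p w)).
Proof.
rewrite /mono_count (bigD1 x) //= mul2n -addnn -addnA; congr (_ + _).
rewrite (eq_bigr (fun v => (adj H x v && (p x == p v)) +
  \sum_(w | w != x) (adj H v w && (p v == p w)))) => [|v vx].
  by rewrite big_split; congr (_ + _); rewrite [RHS](bigD1 x) //= adjxx.
by rewrite (bigD1 x) //= adj_sym eq_sym.
Qed.

(** A global minimiser of [mono_count]: it is no worse than [p0], and moving [x] to part [i] cannot
    improve it. *)
Lemma max_cut (p0 : W -> 'I_r) : exists2 p : W -> 'I_r, mono_count p <= mono_count p0 &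
  forall x i, \sum_w (adj H x w && (p x == p w)) <= #|[set w in part p i | adj H x w]|.
Proof.
pose p1 := [ffun v => p0 v].
case: (arg_minnP (fun p : {ffun W -> 'I_r} => mono_count p) (erefl true : xpredT p1)) => p _ min_p.
exists p => [|x i].
  apply: leq_trans (min_p p1 isT) _; apply: leq_sum => v _; apply: leq_sum => w _.
  by rewrite !ffunE.
have := min_p [ffun v => if v == x then i else p v] isT.
set q := finfun _; have qE v : v != x -> q v = p v by move=> vx; rewrite ffunE (negPf vx).
rewrite /= (mono_count_split p x) (mono_count_split q x).
have -> : \sum_(v | v != x) \sum_(w | w != x) (adj H v w && (q v == q w)) =
    \sum_(v | v != x) \sum_(w | w != x) (adj H v w && (p v == p w)).
  by apply: eq_bigr => v vx; apply: eq_bigr => w wx; rewrite !qE.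
rewrite leq_add2r leq_mul2l /= => /leq_trans; apply.
rewrite -sum1_card [leqRHS]big_mkcond; apply: leq_sum => w _; rewrite !inE ffunE eqxx.
have [->|wx] := eqVneq w x; first by rewrite adjxx.
by rewrite qE // eq_sym andbC; case: (_ && _).
Qed.

End MaxCut.

(** * From few copies of F to few cliques *)

Section FewCliques.
Local Open Scope ring_scope.
Variables (R : realFieldType) (V W : finType) (F : sgraph V) (H : sgraph W).
Variables (C : eqType) (c : V -> C) (S : {set V}).
Hypothesis W_gt0 : (0 < #|W|)%N.
Hypothesis c_proper : forall a b, adj F a b -> c a != c b.
Hypotheses (c_inj : {in S &, injective c}) (c_onto : forall z, exists2 i, i \in S & c z = c i).

Local Notation n := (#|W|%:R : R).
Local Notation f := #|V|.

Lemma avg_not_injective :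
  avg (fun phi : {ffun V -> W} => (~~ injectiveb phi)%:R) <= f%:R ^+ 2 / n :> R.
Proof.
have n_gt0 : 0 < n by rewrite ltr0n.
apply: le_trans (_ : avg (fun phi : {ffun V -> W} =>
    \sum_s \sum_(t | s != t) (phi s == phi t)%:R) <= _).
  apply: ler_avg => phi; case: (boolP (injectiveb phi)) => [_|/injectivePn[s [t st Est]]] /=.
    by rewrite sumr_ge0 // => s _; rewrite sumr_ge0.
  rewrite (bigD1 s) //= (bigD1 t) //= Est eqxx -addrA lerDl addr_ge0 ?sumr_ge0 // => i _.
  by rewrite sumr_ge0.
rewrite avg_sum; apply: le_trans (_ : \sum_(s : V) \sum_(t : V) 1 / n <= _); last first.
  rewrite !sumr_const -mulrnA -[_ *+ (_ * _)]mulr_natl natrM -expr2.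
  by rewrite mul1r.
apply: ler_sum => s _; rewrite avg_sum big_mkcond; apply: ler_sum => t _.
case: ifP => [st|_]; last by rewrite divr_ge0 ?ltW.
rewrite (avg_coord2 W_gt0 (fun w x => (w == x)%:R) st).
rewrite (eq_bigr (fun=> 1)) => [|w _]; last first.
  by rewrite (bigD1 w) //= eqxx big1 ?addr0 // => x /negPf; rewrite eq_sym => ->.
by rewrite sumr_const le_eqVlt; apply/orP; left; apply/eqP; field; rewrite gt_eqF.
Qed.

(** On [S] distinct vertices have distinct colours, so the coloured density is the clique density.
    After the blow-up, [c] being proper makes every counted map a homomorphism of [F]; the last term
    removes the non-injective ones. *)
Lemma few_cliques : clique_density R (adj H) S ^+ (2 ^ #|~: S|) <=
  #|[set phi : {ffun V -> W} | inj_hom F H phi]|%:R / n ^+ f + f%:R ^+ 2 / n.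
Proof.
have -> : clique_density R (adj H) S = hom_density R (adj H) c S.
  apply: eq_avg => phi; congr (_%:R); congr nat_of_bool.
  apply/hom_onP/hom_onP => h i j iS jS.
    by move=> cij; apply: h => //; apply: contra cij => /eqP ->.
  by move=> ij; apply: h => //; apply: contra ij => /eqP/c_inj ->.
apply: le_trans (@hom_density_blowup R V W (adj H) (@adj_sym W H) W_gt0 C c S c_onto) _.
rewrite -avg_card; apply: le_trans (lerD (lexx _) avg_not_injective).
rewrite -avgD; apply: ler_avg => phi; rewrite -natrD ler_nat.
case: (boolP (hom_on _ _ _ _)) => // /hom_onP h; rewrite /inj_hom.
case: (injectiveb phi) => //=; rewrite addn0 lt0b.
by apply/forallP => a; apply/forallP => b; apply/implyP => /c_proper; apply: h; rewrite ?inE.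
Qed.

End FewCliques.

(** * Sizes of the parts of a nearly optimal cut *)

Section PartSizes.
Local Open Scope ring_scope.
Variables (R : realFieldType) (r : nat) (W : finType) (p : W -> 'I_r).
Hypotheses (r_gt0 : (0 < r)%N) (W_gt0 : (0 < #|W|)%N) (rW3 : (3 * r <= #|W|)%N).
Local Notation n := (#|W|%:R : R).

(** The squared deviations of the part sizes from [n / r] sum to [part_squares p - n ^+ 2 / r],
    which is at most the deficit plus [n]. Hence no part deviates by more than [n / (2r)]. *)
Lemma part_lower (mu : R) i :
  2 * (turan_size r #|W|)%:R - (cross_pairs p)%:R <= mu * n ^+ 2 ->
  1 / n + mu <= (2 * r%:R)^-1 ^+ 2 -> (2 * r%:R)^-1 * n <= #|part p i|%:R.
Proof.
move=> D_small mu_small.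
have n_gt0 : 0 < n by rewrite ltr0n.
have rR : 0 < r%:R :> R by rewrite ltr0n.
have sq : (cross_pairs p)%:R + (part_squares p)%:R = n ^+ 2 :> R.
  by rewrite -natrD cross_pairs_squares natrX.
have T_ge : n ^+ 2 <= 2 * (turan_size r #|W|)%:R + n ^+ 2 / r%:R + n.
  have := turan_size_ge r_gt0 rW3; rewrite -(ler_nat R) natrD !natrM natrD => h.
  rewrite -(ler_pM2l rR) expr2; apply: le_trans h _.
  by rewrite le_eqVlt; apply/orP; left; apply/eqP; field; rewrite gt_eqF.
have var : \sum_j (#|part p j|%:R - n / r%:R) ^+ 2 = (part_squares p)%:R - n ^+ 2 / r%:R.
  rewrite (eq_bigr (fun j => #|part p j|%:R ^+ 2 +
    (- (2 * (n / r%:R)) * #|part p j|%:R + (n / r%:R) ^+ 2))) => [|j _]; last by ring.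
  rewrite !big_split /= -mulr_sumr -natr_sum sum_part sumr_const card_ord.
  rewrite -[(_ / _) ^+ 2 *+ r]mulr_natl /part_squares natr_sum.
  rewrite (eq_bigr (fun j => (#|part p j| ^ 2)%:R)) => [|j _]; last by rewrite natrX.
  by field; rewrite gt_eqF.
have var_i : (#|part p i|%:R - n / r%:R) ^+ 2 <= ((2 * r%:R)^-1 * n) ^+ 2.
  apply: le_trans (_ : \sum_j (#|part p j|%:R - n / r%:R) ^+ 2 <= _).
    by rewrite (bigD1 i) //= lerDl sumr_ge0 // => j _; rewrite sqr_ge0.
  rewrite var; apply: le_trans (_ : n + mu * n ^+ 2 <= _); first by lra.
  rewrite exprMn; apply: le_trans (ler_wpM2r (exprn_ge0 2 (ltW n_gt0)) mu_small).
  by rewrite mulrDl lerD2r expr2 mulrA divfK ?gt_eqF // mul1r.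
set t := (2 * r%:R)^-1 * n in var_i *.
have t0 : 0 < t by rewrite mulr_gt0 // invr_gt0 mulr_gt0.
have tE : n / r%:R = 2 * t by rewrite /t; field; rewrite gt_eqF.
rewrite leNgt; apply/negP => lt_t; move: var_i; rewrite tE leNgt => /negP; apply.
have : t < 2 * t - #|part p i|%:R by lra.
move=> h; rewrite -[X in _ < X]sqrrN opprB ltr_pXn2r ?nnegrE //; lra.
Qed.

End PartSizes.

(** * The main theorem *)

Lemma mono_count_mono_deg (R : realFieldType) (r : nat) (W : finType) (H : sgraph W)
    (p : W -> 'I_r) : (\sum_w mono_deg R H p w = (mono_count H p)%:R)%R.
Proof.
by rewrite /mono_count natr_sum; apply: eq_bigr => w _; rewrite natr_sum.
Qed.

Section Main.
Local Open Scope ring_scope.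
Variables (R : realType) (r : nat) (V : finType) (F : sgraph V).
Hypotheses (r_gt1 : (1 < r)%N) (F_crit : critical r F).
Local Notation f := #|V|.

Let r_gt0 : (0 < r)%N. Proof. exact: ltnW. Qed.
Let rR : 0 < r%:R :> R. Proof. by rewrite ltr0n. Qed.
Let f_gt0 : (0 < f)%N.
Proof.
have [u _] := critical_coloringP F_crit.
by apply/card_gt0P; exists u.
Qed.
Let fR : 0 < f%:R :> R. Proof. by rewrite ltr0n. Qed.
Let ffR : 0 < (f ^ f)%:R :> R. Proof. by rewrite ltr0n expn_gt0 f_gt0. Qed.

Section Core.
Variables tau eps kappa eta mu zeta delta : R.
Hypotheses (tauE : tau = (2 * r%:R)^-1) (kappa_gt0 : 0 < kappa).
Hypotheses (eta_gt0 : 0 < eta) (eta_le1 : eta <= 1) (eta_kappa : 4 * eta <= kappa).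
Hypotheses (mu0 : 0 < mu) (mu1 : 4 * (f%:R ^+ 2 * (mu + mu)) <= eta ^+ f.+1)
  (mu2 : 2 * (f%:R ^+ 2 * (mu + mu + 2 * kappa)) <= tau ^+ f)
  (mu3 : mu + mu <= tau ^+ 2).
Hypothesis eps_small : 6 * eps * f%:R ^+ 4 * (f ^ f)%:R <= tau ^+ f / 2.
Hypotheses (zeta_eta : zeta <= eta ^+ f.+1 / 2) (zeta_eps : zeta <= eps * (tau ^+ f / 2)).
Hypothesis delta_le1 : delta <= 1.
Hypothesis delta_zeta : delta * ((f ^ f)%:R * f%:R ^+ 2) <= zeta.

Let tau_gt0 : 0 < tau. Proof. by rewrite tauE invr_gt0 mulr_gt0. Qed.
Let tau_le1 : tau <= 1. Proof. by rewrite tauE; have /andP[] := tau01 R r_gt0. Qed.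

(** [tau] is the relative size of a part, [eta] and [kappa] are thresholds for monochromatic and
    missing degrees, [mu] bounds [oB / n ^+ 2], and [eps] separates few from many monochromatic
    edges. Many of them force [zeta * n * K] injective homomorphisms, more than [delta] allows. *)
Lemma copies_lower_bound : exists n0 : nat, forall n q : nat,
  (n0 <= n)%N -> (1 <= q)%N -> q%:R < delta * n%:R ->
  forall (W : finType) (H : sgraph W), #|W| = n -> #|edges H| = (turan_size r n + q)%N ->
  (q * min_copies r n F <= copies F H)%N.
Proof.
have [g g0 stab] := stability r_gt1 mu0.
have [c1 c1P c1_onto] := critical_surjective_coloring r_gt0 F_crit.
have [rep repK] := fin_all_exists c1_onto.
have rep_inj : injective rep by move=> i j /(congr1 c1); rewrite !repK.
pose S0 := [set rep i | i : 'I_r.+1].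
have S0_card : #|S0| = r.+1 by rewrite card_imset // card_ord.
have S0_onto z : exists2 i, i \in S0 & c1 z = c1 i.
  by exists (rep (c1 z)); rewrite ?imset_f ?repK.
have S0_inj : {in S0 &, injective c1}.
  by move=> _ _ /imsetP[i _ ->] /imsetP[j _ ->]; rewrite !repK => ->.
pose G := g ^+ (2 ^ #|~: S0|); have G0 : 0 < G by rewrite exprn_gt0.
pose P : R := (f ^ f)%:R * f%:R ^+ 2 + f%:R ^+ 2.
have P0 : 0 < P by rewrite addr_gt0 ?mulr_gt0 ?exprn_gt0.
(* [n > X] yields [3 / n <= mu], [1 / n <= g] and [P / n < G]. The two terms of [P] account for the
   maps of the few copies and for the non-injective maps; [G] is the value at clique density [g] of
   the power in [few_cliques]. *)
pose X := 3 / mu + g^-1 + P / G.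
have [x10 x20 x30] : [/\ 0 < 3 / mu, 0 < g^-1 & 0 < P / G].
  by split; [apply: divr_gt0 | rewrite invr_gt0 | apply: divr_gt0].
have X0 : 0 <= X by rewrite ltW // addr_gt0 // addr_gt0.
exists (maxn (3 * r) (Num.bound X)) => n q n_large q_gt0 q_small W H Wn.
subst n => H_edges.
have rW3 : (3 * r <= #|W|)%N by apply: leq_trans n_large; apply: leq_maxl.
have rW : (r < #|W|)%N by apply: leq_trans rW3; move: r_gt0; clear; lia.
have rW2 : (2 * r <= #|W|)%N by apply: leq_trans rW3; rewrite leq_mul2r orbT.
have W_gt0 : (0 < #|W|)%N by apply: leq_ltn_trans rW.
have n_gt0 : 0 < #|W|%:R :> R by rewrite ltr0n.
set n := #|W|%:R in q_small n_gt0.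
have nX : X < n.
  apply: lt_le_trans (archi_boundP X0) _; rewrite ler_nat.
  by apply: leq_trans n_large; apply: leq_maxr.
have n_mu3 : 3 / n <= mu.
  rewrite ler_pdivrMr // mulrC -ler_pdivrMr //; apply/ltW; apply: le_lt_trans nX.
  by rewrite /X; lra.
have n_mu : 1 / n <= mu.
  by apply: le_trans n_mu3; rewrite ler_pM2r ?invr_gt0 // ler1n.
have n_g : n^-1 <= g.
  rewrite invf_ple ?posrE //; apply/ltW; apply: le_lt_trans nX; rewrite /X; lra.
have n_G : P / n < G.
  rewrite ltr_pdivrMr // mulrC -ltr_pdivrMr //; apply: le_lt_trans nX; rewrite /X; lra.
pose K := n ^+ f / n ^+ 2; have K0 : 0 < K by rewrite divr_gt0 ?exprn_gt0.
rewrite leqNgt; apply/negP => few.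
have c_low : 6 * eps * f%:R ^+ 4 * K <= (min_copies r #|W| F)%:R.
  have small : f%:R ^+ 2 * (3 / #|W|%:R) <= tau ^+ f / 2.
    have := ler_wpM2l (exprn_ge0 2 (ler0n R f)) n_mu3; rewrite -/n.
    have : 0 < f%:R ^+ 2 * kappa by rewrite mulr_gt0 ?exprn_gt0.
    have := exprn_gt0 f tau_gt0; move: mu2; lra.
  rewrite tauE in small; have c_low := min_copies_lower r_gt0 F_crit rW rW2 small.
  rewrite -(ler_pM2r ffR); apply: le_trans c_low; rewrite -tauE -/n.
  have := ler_wpM2r (ltW K0) eps_small; rewrite [leRHS]mulrA; apply: le_trans.
  by rewrite le_eqVlt; apply/orP; left; apply/eqP; ring.
have c_up : (min_copies r #|W| F)%:R <= f%:R ^+ 2 * K.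
  have [x _] : exists x : W, x \in W by apply/card_gt0P.
  have [p' [bal _ _ _]] := balance r_gt0 (fun=> Ordinal r_gt0) x x rW3.
  have /injectivePn[y [z yz p'yz]] : ~~ injectiveb p'.
    by apply/injectiveP => /leq_card; rewrite card_ord leqNgt rW.
  apply: le_trans (_ : (copies F (multipartite_plus p' [set y; z]))%:R <= _).
    by rewrite ler_nat; apply: min_copies_le.
  by rewrite /K mulrA; apply: copies_plus_upper.
pose inj := #|[set phi : {ffun V -> W} | inj_hom F H phi]|%:R : R.
have inj_small : inj < delta * n * (f%:R ^+ 2 * K) * (f ^ f)%:R.
  apply: le_lt_trans (_ : (copies F H)%:R * (f ^ f)%:R < _).
    by rewrite -natrM ler_nat card_inj_hom_le.
  rewrite ltr_pM2r //; apply: lt_le_trans (_ : (q * min_copies r #|W| F)%:R <= _).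
    by rewrite ltr_nat.
  by rewrite natrM ler_pM ?ler0n // ltW.
have inj_zeta : inj < zeta * n * K.
  apply: lt_le_trans inj_small _.
  rewrite -[leRHS]mulrA; apply: le_trans (ler_wpM2r (ltW (mulr_gt0 n_gt0 K0)) delta_zeta).
  by rewrite le_eqVlt; apply/orP; left; apply/eqP; ring.
have inj_n : inj / n ^+ f + f%:R ^+ 2 / n < G.
  apply: lt_trans n_G; rewrite /P [(_ + _) / n]mulrDl ltrD2r ltr_pdivrMr ?exprn_gt0 //.
  apply: lt_le_trans inj_small _.
  apply: le_trans (_ : 1 * n * (f%:R ^+ 2 * K) * (f ^ f)%:R <= _).
    have pos : 0 <= f%:R ^+ 2 * K by rewrite mulr_ge0 ?exprn_ge0 // ltW.
    by rewrite ler_pM2r // ler_wpM2r // ler_pM2r.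
  by rewrite le_eqVlt; apply/orP; left; apply/eqP; rewrite /K; field; rewrite gt_eqF.
have cliques : clique_density R (adj H) S0 <= g.
  rewrite leNgt; apply/negP => big; move: inj_n; apply/negP; rewrite -leNgt.
  apply: le_trans (few_cliques R H W_gt0 c1P S0_inj S0_onto).
  by rewrite lerXn2r ?nnegrE ?clique_ge0 ?ltW.
have edges_ge : 1 - r%:R^-1 - g <= (\sum_w \sum_v (adj H w v)%:R) / #|W|%:R ^+ 2.
  have := turan_size_ge r_gt0 rW3; rewrite -(ler_nat R) natrD !natrM natrD => h.
  have -> : \sum_w \sum_v (adj H w v)%:R = 2 * (turan_size r #|W| + q)%:R :> R.
    rewrite -H_edges -natrM -card_adj natr_sum.
    by apply: eq_bigr => w _; rewrite natr_sum.
  apply: le_trans (_ : 1 - r%:R^-1 - n^-1 <= _); first by rewrite lerB.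
  rewrite -/n ler_pdivlMr ?exprn_gt0 // -(ler_pM2l rR).
  rewrite (_ : r%:R * _ = r%:R * (n * n) - n * (n + r%:R)); last first.
    by field; rewrite !gt_eqF.
  rewrite lerBlDr; apply: le_trans h _; rewrite lerD2r ler_pM2l // ler_pM2l //.
  by rewrite ler_nat leq_addr.
have [p0 p0P] := stab V W (adj H) S0 (@adj_sym W H) W_gt0 S0_card edges_ge cliques.
have [p p_le p_cut] := max_cut H p0.
have B_small : \sum_w mono_deg R H p w <= mu * n ^+ 2.
  rewrite mono_count_mono_deg; apply: le_trans p0P.
  apply: le_trans (_ : (mono_count H p0)%:R <= _); first by rewrite ler_nat.
  by rewrite -mono_count_mono_deg.
have bal := mono_missing_balance R H_edges p.
have D0 := deficit_ge0 R r_gt0 W_gt0 rW3 p.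
have MB : \sum_w missing_deg R H p w <= \sum_w mono_deg R H p w.
  by rewrite bal addrAC lerDr addr_ge0 ?mulr_ge0.
have M0 : 0 <= \sum_w missing_deg R H p w by rewrite sumr_ge0 // => w _; exact: missing_deg_ge0.
have parts i : tau * n <= #|part p i|%:R.
  rewrite tauE; apply: (@part_lower R r W p r_gt0 W_gt0 rW3 mu).
    by apply: le_trans B_small; rewrite bal lerDr addr_ge0 ?mulr_ge0.
  by rewrite -/n -tauE (le_trans _ mu3) // lerD2r.
have M_small := le_trans MB B_small.
have [B_le|B_gt] := lerP (\sum_w mono_deg R H p w) (2 * eps * n).
  have : (q * min_copies r #|W| F <= copies F H)%N.
    apply: (few_mono_edges r_gt0 F_crit W_gt0 rW rW3 H_edges B_le).
    exact: c_low.
  by rewrite leqNgt few.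
have [/existsP[x eta_x]|] := boolP [exists x, eta * n <= mono_deg R H p x].
  have : eta ^+ f.+1 / 2 * n * K <= inj.
    apply: (high_mono_degree F_crit W_gt0 _ _ eta_x M_small).
    - by move=> i; apply: le_trans (_ : (\sum_w (adj H x w && (p x == p w)))%:R <= _);
        [rewrite natr_sum | rewrite ler_nat].
    - by rewrite eta_gt0.
    - apply: le_trans mu1; rewrite ler_wpM2l // ler_wpM2l ?exprn_ge0 ?ler0n // lerD2r.
      exact: n_mu.
  apply/negP; rewrite -ltNge; apply: lt_le_trans inj_zeta _.
  by rewrite !ler_pM2r.
rewrite negb_exists => /forallP low.
have : eps * (tau ^+ f / 2) * n * K <= inj.
  apply: (@low_mono_degrees R r V F F_crit W H p W_gt0 tau eps eta kappa mu) => //.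
  - by rewrite ltW.
  - by move=> x; move: (low x); rewrite -ltNge => /ltW.
  - exact: ltW.
  - exact: ltW.
  - apply: le_trans mu2; rewrite ler_wpM2l // ler_wpM2l ?exprn_ge0 ?ler0n // lerD2r.
    by rewrite lerD2r; exact: n_mu3.
apply/negP; rewrite -ltNge; apply: lt_le_trans inj_zeta _.
by rewrite !ler_pM2r.
Qed.

End Core.
End Main.

Theorem theorem3 (R : realType) (r : nat) (hr : 2 <= r)
    (V : finType) (F : sgraph V) (hF : critical r F) :
  exists2 delta : R, (0 < delta)%R &
    exists n0 : nat, forall n q : nat,
      n0 <= n -> 1 <= q -> (q%:R < delta * n%:R)%R ->
      forall (W : finType) (H : sgraph W),
        #|W| = n -> #|edges H| = turan_size r n + q ->
        q * min_copies r n F <= copies F H.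
Proof.
Local Open Scope ring_scope.
have [u _] := critical_coloringP hF.
have f_gt0 : (0 < #|V|)%N by apply/card_gt0P; exists u.
set f := #|V| in f_gt0.
have fR : 1 <= f%:R :> R by rewrite ler1n.
have f2_gt0 : 0 < f%:R ^+ 2 :> R by rewrite exprn_gt0 // (lt_le_trans ltr01).
have f4_gt0 : 0 < f%:R ^+ 4 :> R by rewrite exprn_gt0 // (lt_le_trans ltr01).
have ff_gt0 : 0 < (f ^ f)%:R :> R by rewrite ltr0n expn_gt0 f_gt0.
have [tau tauE] : exists t : R, t = (2 * r%:R)^-1 by exists (2 * r%:R)^-1.
have tau_gt0 : 0 < tau by rewrite tauE invr_gt0 mulr_gt0 // ltr0n ltnW.
have tau_le1 : tau <= 1 by rewrite tauE; have /andP[] := tau01 R (ltnW hr).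
have tauf_gt0 : 0 < tau ^+ f by rewrite exprn_gt0.
have tauf_le1 : tau ^+ f <= 1 by rewrite exprn_ile1 // ltW.
(* With 16, [kappa] uses a quarter of [tau ^+ f] in the second condition on [mu], and the bound on
   [mu] chosen below uses at most another half. *)
have [kappa kappa_gt0 kappaE] : exists2 k : R, 0 < k & 16 * (k * f%:R ^+ 2) = tau ^+ f.
  exists (tau ^+ f / (16 * f%:R ^+ 2)); first by rewrite divr_gt0 ?mulr_gt0 ?ltr0n.
  by field; rewrite gt_eqF // (lt_le_trans ltr01).
have [eta eta_gt0 etaE] : exists2 e : R, 0 < e & 4 * e = kappa.
  by exists (kappa / 4); [rewrite divr_gt0 ?ltr0n | field].
have eta_le1 : eta <= 1.
  have : kappa * 1 <= kappa * f%:R ^+ 2 by rewrite ler_pM2l // exprn_ege1.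
  by rewrite mulr1; lra.
have etaf_gt0 : 0 < eta ^+ f.+1 by rewrite exprn_gt0.
have [mu mu_gt0 [mu1 mu2 mu3]] : exists2 m : R, 0 < m &
    [/\ m * (8 * f%:R ^+ 2) <= eta ^+ f.+1, m * (8 * f%:R ^+ 2) <= tau ^+ f &
     m * 2 <= tau ^+ 2].
  have f8 : 0 < 8 * f%:R ^+ 2 :> R by rewrite mulr_gt0 ?ltr0n.
  exists (Num.min (eta ^+ f.+1 / (8 * f%:R ^+ 2))
      (Num.min (tau ^+ f / (8 * f%:R ^+ 2)) (tau ^+ 2 / 2))).
    by rewrite !lt_min !divr_gt0 ?exprn_gt0 ?ltr0n.
  split; rewrite -ler_pdivlMr ?ltr0n // !ge_min lexx ?orbT //.
have [eps eps_gt0 epsE] : exists2 e : R, 0 < e &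
    6 * e * f%:R ^+ 4 * (f ^ f)%:R = tau ^+ f / 2.
  exists (tau ^+ f / (12 * f%:R ^+ 4 * (f ^ f)%:R)).
    by rewrite divr_gt0 // mulr_gt0 // mulr_gt0 ?ltr0n.
  by field; rewrite !gt_eqF // (lt_le_trans ltr01).
pose zeta := Num.min (eta ^+ f.+1 / 2) (eps * (tau ^+ f / 2)).
have zeta_gt0 : 0 < zeta.
  by rewrite lt_min; apply/andP; split; [|apply: mulr_gt0 => //]; apply: divr_gt0.
have ff2 : 0 < (f ^ f)%:R * f%:R ^+ 2 :> R by rewrite mulr_gt0.
exists (Num.min 1 (zeta / ((f ^ f)%:R * f%:R ^+ 2))).
  by rewrite lt_min ltr01 divr_gt0.
apply: (copies_lower_bound hr hF tauE kappa_gt0 eta_gt0 eta_le1 _ mu_gt0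
  (eps := eps) (zeta := zeta)).
- by rewrite etaE.
- by rewrite -/f; move: mu1; lra.
- rewrite -/f; move: mu2 kappaE tauf_gt0; move: (tau ^+ f) => t; lra.
- by move: mu3; lra.
- by rewrite -/f epsE.
- by rewrite ge_min lexx.
- by rewrite ge_min lexx orbT.
- by rewrite ge_min lexx.
- by rewrite -ler_pdivlMr // ge_min lexx orbT.
Qed.
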